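(* $T_\infty$ satisfies existence: every (small) set of parameters $A\subseteq\mathfrak{C}\models T_\infty$ is an extension base, i.e. no consistent formula over $A$ forks over $A$.
   Context: Fix $p$ equal to $0$ or a prime different from $2$. $L$ is the two-sorted language with a sort $V$ (vectors) and a sort $K$ (scalars), with symbols for $0_V,0_K,1_K$, vector addition, field addition and multiplication, scalar multiplication $K\times V\to V$, and a map $[\cdot,\cdot]:V\times V\to K$. $T_\infty$ denotes either of the two (complete) $L$-theories saying that $K$ is an algebraically closed field of characteristic $p$, $V$ is an infinite-dimensional $K$-vector space and $[\cdot,\cdot]$ is a nondegenerate symmetric (first theory), respectively nondegenerate alternating (second theory), $K$-bilinear form. $\mathfrak{C}$ is a monster model: $\bar\kappa$-saturated and $\bar\kappa$-strongly homogeneous for a sufficiently large $\bar\kappa$; small means of size less than $\bar\kappa$. Forking has its standard model-theoretic meaning. *)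

(* Defs.v *)
From HB Require Import structures.
From mathcomp Require Import all_boot all_order all_algebra sesquilinear.
From mathcomp Require Import boolp classical_sets cardinality.

Set Implicit Arguments.
Unset Strict Implicit.
Unset Printing Implicit Defensive.

Import GRing.Theory.
Local Open Scope classical_set_scope.
Local Open Scope card_scope.
Local Open Scope ring_scope.

(** * Syntax of the two-sorted language *)

Variant sort := vec | sca.

(* A finite tuple of sorted variables is given by its list of sorts; the
   variables are the positions in that list. *)
Definition ctx := seq sort.

Fixpoint var (x : ctx) : Set :=
  if x is _ :: x' then option (var x') else Empty_set.

Fixpoint srt (x : ctx) : var x -> sort :=
  match x return var x -> sort with
  | [::] => fun i => match i with end
  | s :: x' => fun i => if i is Some j then srt j else s
  end.

Inductive term (x : ctx) : sort -> Set :=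
| tvar (i : var x) : term x (srt i)
| tzeroV : term x vec
| tzeroK : term x sca
| toneK : term x sca
| taddV : term x vec -> term x vec -> term x vec
| taddK : term x sca -> term x sca -> term x sca
| tmulK : term x sca -> term x sca -> term x sca
| tscale : term x sca -> term x vec -> term x vec
| tform : term x vec -> term x vec -> term x sca.

(* [formula x]: first-order formulas with free variables among [x]; the
   remaining connectives and the existential quantifier are definable. *)
Inductive formula (x : ctx) : Set :=
| ffalse : formula x
| feq (s : sort) : term x s -> term x s -> formula x
| fimp : formula x -> formula x -> formula x
| fall (s : sort) : formula (s :: x) -> formula x.

(** * The theories [T_infinity] *)

Variant form_kind := SymmetricForm | AlternatingForm.

Definition has_char (K : fieldType) (p : nat) : Prop :=
  if p == 0%N then [pchar K] =i pred0 else p \in [pchar K].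

Definition infinite_dimensional (K : fieldType) (V : lmodType K) : Prop :=
  forall n, exists v : 'I_n -> V,
    forall c : 'I_n -> K, \sum_(i < n) c i *: v i = 0 -> forall i, c i = 0.

Definition nondegenerate_form (K : fieldType) (V : lmodType K)
    (B : V -> V -> K) : Prop :=
  forall v, (forall w, B v w = 0) -> v = 0.

Definition form_of_kind (k : form_kind) (K : fieldType) (V : lmodType K)
    (B : V -> V -> K) : Prop :=
  match k with
  | SymmetricForm => forall v w, B v w = B w v
  | AlternatingForm => forall v, B v v = 0
  end.

(* Algebraic closedness of [K], the vector space axioms and bilinearity of [B]
   are carried by the types. *)
Definition model_of_Tinfty (k : form_kind) (p : nat) (K : closedFieldType)
    (V : lmodType K) (B : {biscalar V}) : Prop :=
  [/\ has_char K p, infinite_dimensional V,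
      nondegenerate_form B & form_of_kind k B].

Section Structure.

Variables (K : closedFieldType) (V : lmodType K) (B : {biscalar V}).

(** * Semantics *)

Definition dom (s : sort) : Type := match s with vec => V | sca => K end.

(* The universe, i.e. the disjoint union of the two sorts. *)
Definition elt : Type := {s : sort & dom s}.

Definition tup (x : ctx) : Type := forall i : var x, dom (srt i).

Definition tup_cons (s : sort) (x : ctx) (d : dom s) (a : tup x) :
    tup (s :: x) :=
  fun i => match i return dom (@srt (s :: x) i) with
           | Some j => a j
           | None => d
           end.

Fixpoint tup_cat (x y : ctx) : tup x -> tup y -> tup (x ++ y) :=
  match x return tup x -> tup y -> tup (x ++ y) with
  | [::] => fun _ b => b
  | s :: x' => fun a b =>
      tup_cons (a None : dom s) (tup_cat (fun j : var x' => a (Some j)) b)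
  end.

Fixpoint teval (x : ctx) (a : tup x) (s : sort) (t : term x s) : dom s :=
  match t in term _ s return dom s with
  | tvar i => a i
  | tzeroV => (0 : V)
  | tzeroK => (0 : K)
  | toneK => (1 : K)
  | taddV t u => (teval a t : V) + (teval a u : V)
  | taddK t u => (teval a t : K) + (teval a u : K)
  | tmulK t u => (teval a t : K) * (teval a u : K)
  | tscale t u => (teval a t : K) *: (teval a u : V)
  | tform t u => B (teval a t : V) (teval a u : V)
  end.

Fixpoint sat (x : ctx) (a : tup x) (phi : formula x) : Prop :=
  match phi with
  | ffalse => False
  | feq _ t u => teval a t = teval a u
  | fimp phi psi => sat a phi -> sat a psi
  | fall s phi => forall d : dom s, sat (tup_cons d a) phi
  end.

Definition tup_in (A : set elt) (x : ctx) (a : tup x) : Prop :=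
  forall i, A (existT dom (srt i) (a i)).

(* A formula [phi(x, b)] with parameters: [phi(x, y)] together with a value
   [b] for [y]. *)
Record pformula (x : ctx) := PFormula {
  pctx : ctx;
  pform : formula (x ++ pctx);
  pval : tup pctx
}.
Arguments pval {x} p _.

Definition holds (x : ctx) (phi : pformula x) (a : tup x) : Prop :=
  sat (tup_cat a (pval phi)) (pform phi).

Definition over (A : set elt) (x : ctx) (phi : pformula x) : Prop :=
  tup_in A (pval phi).

Definition consistent (x : ctx) (phi : pformula x) : Prop :=
  exists a : tup x, holds phi a.

(** * Monster models *)

Definition small (kappa : Type) (A : set elt) : Prop :=
  A #<= [set: kappa] /\ ~ ([set: kappa] #<= A).

Definition saturated (kappa : Type) : Prop :=
  forall (A : set elt) (x : ctx) (Sigma : set (pformula x)),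
    small kappa A ->
    (forall phi, Sigma phi -> over A phi) ->
    (forall (n : nat) (phi : 'I_n -> pformula x),
       (forall i, Sigma (phi i)) -> exists a, forall i, holds (phi i) a) ->
    exists a, forall phi, Sigma phi -> holds phi a.

(* [f], restricted to [A], is a partial elementary map. *)
Definition elementary_on (A : set elt) (f : forall s, dom s -> dom s) : Prop :=
  forall (x : ctx) (phi : formula x) (a : tup x), tup_in A a ->
    (sat a phi <-> sat (fun i => f _ (a i)) phi).

Record automorphism (g : forall s, dom s -> dom s) : Prop := Automorphism {
  aut_bij : forall s, bijective (g s);
  aut_zeroV : g vec (0 : V) = (0 : V);
  aut_zeroK : g sca (0 : K) = (0 : K);
  aut_oneK : g sca (1 : K) = (1 : K);
  aut_addV : forall u v : V, g vec (u + v) = (g vec u : V) + (g vec v : V);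
  aut_addK : forall a b : K, g sca (a + b) = (g sca a : K) + (g sca b : K);
  aut_mulK : forall a b : K, g sca (a * b) = (g sca a : K) * (g sca b : K);
  aut_scale : forall (a : K) (v : V),
    g vec (a *: v) = (g sca a : K) *: (g vec v : V);
  aut_form : forall u v : V, g sca (B u v) = B (g vec u : V) (g vec v : V)
}.

Definition strongly_homogeneous (kappa : Type) : Prop :=
  forall (A : set elt) (f : forall s, dom s -> dom s),
    small kappa A -> elementary_on A f ->
    exists2 g, automorphism g &
      forall s (d : dom s), A (existT dom s d) -> g s d = f s d.

(* Cardinals are represented by types. "Sufficiently large" is read as
   "larger than the cardinality of the language", that is, uncountable. *)
Definition monster (kappa : Type) : Prop :=
  [/\ ~ countable [set: kappa], saturated kappa & strongly_homogeneous kappa].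

(** * Forking *)

Definition same_type_over (A : set elt) (y : ctx) (b b' : tup y) : Prop :=
  forall theta : pformula y, over A theta -> (holds theta b <-> holds theta b').

(* The instances are indexed by [nat] and may repeat: [k]-inconsistency
   concerns any [k] distinct indices. *)
Definition k_inconsistent (x : ctx) (k : nat) (phi : nat -> pformula x) :
    Prop :=
  forall h : 'I_k -> nat, injective h ->
    ~ exists a : tup x, forall j, holds (phi (h j)) a.

Definition divides (A : set elt) (x : ctx) (phi : pformula x) : Prop :=
  exists (k : nat) (b : nat -> tup (pctx phi)),
    (forall i, same_type_over A (b i) (pval phi)) /\
    k_inconsistent k (fun i => PFormula (pform phi) (b i)).

Definition forks (A : set elt) (x : ctx) (phi : pformula x) : Prop :=
  exists (n : nat) (psi : 'I_n -> pformula x),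
    (forall j, divides A (psi j)) /\
    (forall a : tup x, holds phi a -> exists j, holds (psi j) a).

Definition extension_base (A : set elt) : Prop :=
  forall (x : ctx) (phi : pformula x),
    over A phi -> consistent phi -> ~ forks A phi.

End Structure.

(* Main.v *)
Require Import Defs.
From HB Require Import structures.
From mathcomp Require Import all_boot all_order all_algebra sesquilinear.
From mathcomp Require Import boolp classical_sets cardinality.
From mathcomp Require Import ring.

Set Implicit Arguments.
Unset Strict Implicit.
Unset Printing Implicit Defensive.

Import GRing.Theory.
Local Open Scope ring_scope.

(* A formula over [A] uses finitely many parameters, so [A] may be taken finite.
   Let [a] realise [phi] and suppose [phi] is covered by formulas that divide
   over [A]. The entries of [a] are added to [A] one at a time, after moving the
   remaining ones by an automorphism over [A], in such a way that the covering
   formulas still divide over the larger set. Once [a] itself lies in [A] this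
   is absurd: every conjugate over [A] of a formula true of [a] is true of [a].

   An algebraic scalar is absorbed by the pigeonhole principle. A transcendental
   scalar is first moved to be transcendental over [A] and all parameters. A
   vector [v] outside the span of [A] is handled after the scalars [B v v] and
   [B v e], for [e] in [A], have been absorbed: it is moved so that its products
   with the other parameters are algebraically independent. In the last two
   cases a single element can be chosen generic over finitely many conjugates of
   the parameters, and generic elements are conjugate, by a back-and-forth
   argument that needs only that [K] has infinite transcendence degree. *)

(** * Polynomials in several variables over a ring mapped into a field *)

(** One automorphism per absorption step must serve all covering formulas at once. This works
    because it only makes the new element generic over a frame [Cb] naming all their parameters, and
    so can be chosen before the formulas are looked at. Dividing is witnessed by finite lists of
    automorphisms of every length; hence genericity is only ever needed over a finitely generated
    frame, and no infinite sequence has to be rebuilt. What forces the case distinction is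
    uniqueness: two generic elements must be conjugate, so the notion of genericity has to contain
    the whole type over [A]. An algebraic scalar has no generic conjugate, and a vector brings along
    its square and its products with [A], which may be algebraic; hence the order of absorption.
    Scalars are named by elements of countable rings mapped into [K]. Two such maps with the same
    kernel amount to an isomorphism of subrings, so no subfields have to be built, and countability
    makes saturation applicable. *)

Section Tower.

Variable S : countComNzRingType.

(* [tower n] is [S[X_0, ..., X_(n-1)]]. *)
Fixpoint tower (n : nat) : countComNzRingType :=
  if n is n'.+1 then {poly (tower n')} : countComNzRingType else S.

Fixpoint towerC (n : nat) : {rmorphism S -> tower n} :=
  match n return {rmorphism S -> tower n} with
  | 0 => idfun
  | n'.+1 => (@polyC (tower n') \o towerC n')%FUN
  end.

Fixpoint towerX (n i : nat) : tower n :=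
  match n return tower n with
  | 0 => 0
  | n'.+1 => if i == n' then ('X : {poly (tower n')}) else (towerX n' i)%:P
  end.

Lemma comm_morph (R R' : comNzRingType) (f : R -> R') (u : R') :
  commr_rmorph f u.
Proof. by move=> x; exact: mulrC. Qed.

Fixpoint tower_ev (R : comNzRingType) (f : {rmorphism S -> R}) (z : nat -> R)
    (n : nat) : {rmorphism tower n -> R} :=
  match n return {rmorphism tower n -> R} with
  | 0 => f
  | n'.+1 => horner_morph (comm_morph (tower_ev f z n') (z n'))
  end.

Section Ev.
Variables (R : comNzRingType) (f : {rmorphism S -> R}) (z : nat -> R).

Lemma tower_evS n (P : tower n.+1) :
  tower_ev f z n.+1 P = (map_poly (tower_ev f z n) (P : {poly _})).[z n].
Proof. by []. Qed.

Lemma tower_evC n r : tower_ev f z n (towerC n r) = f r.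
Proof. by elim: n => //= n IH; rewrite horner_morphC. Qed.

Lemma tower_evX n i : (i < n)%N -> tower_ev f z n (towerX n i) = z i.
Proof.
elim: n => //= n IH; rewrite ltnS leq_eqVlt.
have [-> _|ne /= lt] := eqVneq i n; first by rewrite horner_morphX.
by rewrite horner_morphC IH.
Qed.

Lemma eq_tower_ev z' n (P : tower n) :
  (forall i, (i < n)%N -> z i = z' i) -> tower_ev f z n P = tower_ev f z' n P.
Proof.
elim: n P => // n IH P eqz; rewrite tower_evS.
rewrite (_ : tower_ev f z' n.+1 P =
  (map_poly (tower_ev f z' n) (P : {poly _})).[z' n]) // eqz //.
congr (_.[_]); apply: eq_map_poly => x; apply: IH => i lt; apply: eqz.
exact: ltnW.
Qed.

End Ev.

Lemma tower_ev_comp (R R' : comNzRingType) (f : {rmorphism S -> R})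
    (g : {rmorphism R -> R'}) (z : nat -> R) n (P : tower n) :
  g (tower_ev f z n P) = tower_ev (g \o f)%FUN (g \o z) n P.
Proof.
elim: n P => // n IH P; rewrite !tower_evS -horner_map -map_poly_comp.
by congr (_.[_]); apply: eq_map_poly => x /=; rewrite IH.
Qed.

End Tower.

(** * Ring maps into an algebraically closed field: kernels, genericity, algebraic extension *)

Section Field.

Variable K : closedFieldType.

Lemma poly_eq0_horner (q : {poly K}) : (forall d, q.[d] = 0) -> q = 0.
Proof.
move=> q0; apply/eqP; apply: contraT => /closed_nonrootP[d].
by rewrite rootE q0 eqxx.
Qed.

(** For ring morphisms this says that [f r] and [f' r] correspond under an isomorphism of the two
    images; it stands in for a partial isomorphism of fields. *)
Definition same_kernel (S : countComNzRingType) (f f' : S -> K) :=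
  forall r, f r = 0 <-> f' r = 0.

Lemma same_kernel_sym (S : countComNzRingType) (f f' : S -> K) :
  same_kernel f f' -> same_kernel f' f.
Proof. by move=> h r; split=> /h. Qed.

Lemma same_kernel_eq (S : countComNzRingType) (f f' : {rmorphism S -> K})
  r r' : same_kernel f f' -> f r = f r' <-> f' r = f' r'.
Proof.
move=> h; split=> /eqP; rewrite -subr_eq0 -rmorphB => /eqP/h/eqP;
  by rewrite rmorphB subr_eq0 => /eqP.
Qed.

Definition transcendental (S : countComNzRingType) (f : {rmorphism S -> K})
    (c : K) :=
  forall P : {poly S}, (map_poly f P).[c] = 0 -> map_poly f P = 0.

Definition tower_vanishes (S : countComNzRingType) (f : {rmorphism S -> K})
    n (P : tower S n) :=
  forall z, tower_ev f z n P = 0.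

(* As [K] is infinite, this says that the [z i] are algebraically independent
   over [f S]; vanishing of all values, rather than of all coefficients, is
   what survives a surjective affine change of variables. *)
Definition generic (S : countComNzRingType) (f : {rmorphism S -> K})
    n (z : nat -> K) :=
  forall P : tower S n, tower_ev f z n P = 0 -> tower_vanishes f P.

Section Kernels.
Variables (S : countComNzRingType) (f f' : {rmorphism S -> K}).
Hypothesis ker_ff' : same_kernel f f'.

Lemma map_poly_ker (P : {poly S}) : map_poly f P = 0 <-> map_poly f' P = 0.
Proof.
by split=> /polyP P0; apply/polyP=> i; rewrite coef_map coef0 /=;
  apply/ker_ff'; move: (P0 i); rewrite coef_map coef0.
Qed.

Lemma size_map_ker (P : {poly S}) : size (map_poly f P) = size (map_poly f' P).
Proof.
apply/eqP; rewrite eqn_leq; apply/andP; split; apply/leq_sizeP=> i le;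
  rewrite coef_map /=; apply/ker_ff'; rewrite -[LHS]coef_map;
  exact: (leq_sizeP _ _ (leqnn _)).
Qed.

End Kernels.

(** Vanishing everywhere passes to the coefficients in the last variable, because a nonzero
    polynomial over [K] has a nonroot. At level 0 it is membership in the kernel. *)
Lemma tower_vanishes_ker (S : countComNzRingType) (f f' : {rmorphism S -> K})
    n (P : tower S n) :
  same_kernel f f' -> tower_vanishes f P -> tower_vanishes f' P.
Proof.
move=> h; elim: n P => [|n IH] P P0 z; first exact/h/(P0 z).
suff cz i : tower_vanishes f (P : {poly _})`_i.
  rewrite tower_evS (_ : map_poly _ _ = 0) ?horner0 //.
  by apply/polyP=> i; rewrite coef_map coef0 /=; apply: IH; exact: cz.
move=> y; rewrite -coef_map (_ : map_poly _ _ = 0) ?coef0 //.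
apply: poly_eq0_horner => d.
pose y' k := if k == n then d else y k.
have := P0 y'; rewrite tower_evS {2}/y' eqxx => <-.
congr (_.[_]); apply: eq_map_poly => x; apply: eq_tower_ev => k lt.
by rewrite /y' ltn_eqF.
Qed.

Lemma generic_same_kernel (S : countComNzRingType)
    (f f' : {rmorphism S -> K}) n z z' :
  same_kernel f f' -> generic f n z -> generic f' n z' ->
  same_kernel (tower_ev f z n) (tower_ev f' z' n).
Proof.
move=> h gz gz' P; split=> /[dup].
  by move=> _ /gz/tower_vanishes_ker-/(_ f' h); apply.
by move=> _ /gz'/tower_vanishes_ker-/(_ f (same_kernel_sym h)); apply.
Qed.

Lemma genericS (S : countComNzRingType) (f : {rmorphism S -> K}) n z :
  generic f n z -> transcendental (tower_ev f z n) (z n) -> generic f n.+1 z.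
Proof.
move=> gz tz P; rewrite tower_evS => /tz P0 y.
rewrite tower_evS (_ : map_poly _ _ = 0) ?horner0 //.
apply/polyP=> i; rewrite coef_map coef0 /=; apply: gz.
by rewrite -coef_map P0 coef0.
Qed.

(* Only the leading coefficients that [f] kills obstruct pseudo-division. *)
Lemma truncate_map (S : countComNzRingType) (f : {rmorphism S -> K})
    (P : {poly S}) : map_poly f P != 0 ->
  exists P' : {poly S}, [/\ map_poly f P' = map_poly f P,
    size P' = size (map_poly f P) & f (lead_coef P') != 0].
Proof.
move=> P0; set m := size (map_poly f P).
have m0 : (0 < m)%N by rewrite size_poly_gt0.
have lP : f P`_m.-1 != 0 by rewrite -coef_map -lead_coefE lead_coef_eq0.
have lP' : P`_m.-1 != 0 by apply: contra_neq lP => ->; rewrite rmorph0.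
exists (\poly_(i < m) P`_i).
have sz : size (\poly_(i < m) P`_i) = m by rewrite size_poly_eq.
split=> //; last by rewrite lead_coefE sz coef_poly prednK // leqnn.
apply/polyP=> i; rewrite !coef_map coef_poly /=; case: ltnP => // le.
by rewrite rmorph0 -coef_map; rewrite (leq_sizeP _ _ (leqnn _) _ le).
Qed.

Definition annihilates (S : countComNzRingType) (f : {rmorphism S -> K})
    (d : K) (P : {poly S}) :=
  map_poly f P != 0 /\ (map_poly f P).[d] = 0.

(** Discarding killed leading coefficients from an annihilator of least size cannot shorten it
    further, so the leading coefficient survives [f] and pseudo-division by it loses nothing. *)
Lemma minimal_annihilator (S : countComNzRingType) (f : {rmorphism S -> K})
    d P : annihilates f d P ->
  exists P0 : {poly S}, [/\ annihilates f d P0, (size P0 <= size P)%N,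
    size (map_poly f P0) = size P0, f (lead_coef P0) != 0 &
    forall Q : {poly S}, (size Q < size P0)%N -> (map_poly f Q).[d] = 0 ->
      map_poly f Q = 0].
Proof.
move=> annP.
pose p n := `[< exists P : {poly S}, annihilates f d P /\ size P = n >].
have ex : exists n, p n by exists (size P); apply/asboolP; exists P.
case: (ex_minnP ex) => m /asboolP[P1 [annP1 sz1]] min.
have [P0 [eqm szm lead]] := truncate_map annP1.1.
have le01 : (size P0 <= m)%N by rewrite szm -sz1; exact: size_poly.
have annP0 : annihilates f d P0 by rewrite /annihilates eqm.
have szP0 : size P0 = m.
  apply/eqP; rewrite eqn_leq le01; apply: min; apply/asboolP.
  by exists P0.
exists P0; split=> //.
- by rewrite szP0; apply: min; apply/asboolP; exists P.
- by rewrite eqm szm.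
move=> Q ltQ Qd; apply/eqP; apply: contraT => Q0.
have : (m <= size Q)%N by apply: min; apply/asboolP; exists Q.
by rewrite -szP0 leqNgt ltQ.
Qed.

Lemma pseudo_div (S : countComNzRingType) (P Q : {poly S}) : P != 0 ->
  exists k U R, (lead_coef P ^+ k) *: Q = U * P + R /\ (size R < size P)%N.
Proof.
move=> P0; have [k U R e /(_ P0) lt] := Pdiv.ComRing.redivpP Q P.
by exists k, U, R.
Qed.

Lemma map_lead0 (S : countComNzRingType) (f : {rmorphism S -> K})
  (P : {poly S}) : f (lead_coef P) != 0 -> P != 0.
Proof. by apply: contra_neq => ->; rewrite lead_coef0 rmorph0. Qed.

(** [P] acts as a minimal polynomial: [R] is the pseudo-remainder of [Q], too short to vanish at [d]
    unless all its coefficients are killed. The clause about other [f'] and [d'] lets the same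
    remainder decide the question on both sides. *)
Lemma root_minimal (S : countComNzRingType) (f : {rmorphism S -> K})
    d (P : {poly S}) : annihilates f d P -> f (lead_coef P) != 0 ->
  (forall Q : {poly S}, (size Q < size P)%N -> (map_poly f Q).[d] = 0 ->
      map_poly f Q = 0) ->
  forall Q, exists R : {poly S}, [/\ (size R < size P)%N,
    forall (f' : {rmorphism S -> K}) d', f' (lead_coef P) != 0 ->
      (map_poly f' P).[d'] = 0 ->
      (map_poly f' Q).[d'] = 0 <-> (map_poly f' R).[d'] = 0 &
    (map_poly f Q).[d] = 0 <-> map_poly f R = 0].
Proof.
move=> annP lead min Q.
have [k [U [R [e lt]]]] := pseudo_div Q (map_lead0 lead).
have key (f' : {rmorphism S -> K}) d' : f' (lead_coef P) != 0 ->
      (map_poly f' P).[d'] = 0 ->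
      (map_poly f' Q).[d'] = 0 <-> (map_poly f' R).[d'] = 0.
  move=> l0 Pd; have := congr1 (fun q => (map_poly f' q).[d']) e.
  rewrite map_polyZ rmorphD rmorphM hornerZ hornerD hornerM Pd mulr0 add0r.
  move=> <-; split=> [->|/eqP]; first by rewrite mulr0.
  by rewrite mulf_eq0 rmorphXn expf_eq0 (negPf l0) andbF => /eqP.
exists R; split=> //.
rewrite (key f d lead annP.2); split=> [/min|->]; last by rewrite horner0.
by apply.
Qed.

(** [d'] is a root of the transferred minimal polynomial of [d]. The point is that this polynomial
    is minimal for [d'] too: a proper factorisation would transfer back along the equal kernels. *)
Lemma extend_algebraic (S : countComNzRingType) (f f' : {rmorphism S -> K})
    d P : same_kernel f f' -> annihilates f d P ->
  exists d', forall Q : {poly S},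
    (map_poly f Q).[d] = 0 <-> (map_poly f' Q).[d'] = 0.
Proof.
move=> ker /minimal_annihilator[{}P [annP _ szP leadP minP]].
have leadP' : f' (lead_coef P) != 0.
  by apply: contra_neq leadP => /ker.
have szP' : size (map_poly f' P) = size P by rewrite -(size_map_ker ker).
have szP1 : (1 < size P)%N.
  rewrite -szP; apply: (@root_size_gt1 _ d); first exact: annP.1.
  by apply/rootP; exact: annP.2.
have /closed_rootP[d' /rootP Pd'] : size (map_poly f' P) != 1%N.
  by rewrite szP' gtn_eqF.
have annP' : annihilates f' d' P.
  by split=> //; rewrite -size_poly_eq0 szP' -lt0n ltnW.
exists d'; suff min' (R : {poly S}) : (size R < size P)%N ->
    (map_poly f' R).[d'] = 0 -> map_poly f' R = 0.
  move=> Q; have [R [ltR e eR]] := root_minimal annP leadP minP Q.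
  rewrite eR (e f' d' leadP' Pd') (map_poly_ker ker).
  by split=> [->|/min']; [rewrite horner0 | apply].
move=> ltR Rd; apply/eqP; apply: contraT => R0.
(* A minimal annihilator [R1] of [d'] pseudo-divides [P] with a remainder killed by [f'], hence by
   [f]. Then [d] is a root of the image of [U] or of [R1], both shorter than [P]. *)
have [{R0 Rd} R1 [annR leR szR leadR minR]] :=
  minimal_annihilator (conj R0 Rd).
have ltR1 := leq_ltn_trans leR ltR.
have [k [U [R2 [e lt2]]]] := pseudo_div P (map_lead0 leadR).
have R20 : map_poly f' R2 = 0.
  apply: minR => //; have := congr1 (fun q => (map_poly f' q).[d']) e.
  rewrite map_polyZ rmorphD rmorphM hornerZ hornerD hornerM Pd' annR.2.
  by rewrite !mulr0 add0r.
have {R20} /(map_poly_ker ker) R20 := R20.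
have leadRf : f (lead_coef R1) != 0 by apply: contra_neq leadR => /ker.
have e' := congr1 (map_poly f) e.
rewrite map_polyZ rmorphD rmorphM /= R20 addr0 rmorphXn /= in e'.
have a0 : f (lead_coef R1) ^+ k != 0 by rewrite expf_neq0.
have szR1 : (1 < size (map_poly f R1))%N.
  rewrite (size_map_ker ker); apply: (@root_size_gt1 _ d'); first exact: annR.1.
  by apply/rootP; exact: annR.2.
have U0 : map_poly f U != 0.
  apply: contra_neq annP.1 => U0; apply/eqP; move/eqP: e'.
  by rewrite U0 mul0r scaler_eq0 (negPf a0).
have fR0 : map_poly f R1 != 0 by rewrite -size_poly_gt0 ltnW.
have szU : (size (map_poly f U) < size P)%N.
  rewrite -szP -(size_scale (map_poly f P) a0) e' size_mul //.
  by case: (size (map_poly f R1)) szR1 => [|[|r]] // _; rewrite !addnS leq_addr.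
have /eqP := congr1 (fun q => q.[d]) e'; rewrite hornerZ annP.2 mulr0 hornerM.
rewrite eq_sym mulf_eq0 => /orP[]/eqP e0.
  (* [U] may be longer than its image, so it is truncated before the minimality of [P] applies. *)
  have [U' [eU sU _]] := truncate_map U0.
  by move: U0; rewrite -eU minP ?eqxx ?eU ?sU.
by move: fR0; rewrite minP ?eqxx.
Qed.

End Field.

(** * Linear algebra of the form *)

(** Finite lists are total functions on [nat] of which only a prefix matters; this appends [v] to
    the prefix of length [n]. *)
Definition upd (T : Type) (n : nat) (e : nat -> T) (v : T) : nat -> T :=
  fun i => if i == n then v else e i.

Lemma upd_lt (T : Type) n (e : nat -> T) v i : (i < n)%N -> upd n e v i = e i.
Proof. by move=> lt; rewrite /upd ltn_eqF. Qed.

Lemma upd_eq (T : Type) n (e : nat -> T) v : upd n e v n = v.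
Proof. by rewrite /upd eqxx. Qed.

Lemma sum_upd (K : closedFieldType) (V : lmodType K) n (c : nat -> K) a
    (e : nat -> V) v :
  \sum_(i < n.+1) upd n c a i *: upd n e v i =
  \sum_(i < n) c i *: e i + a *: v.
Proof.
rewrite big_ord_recr /= !upd_eq; congr (_ + _).
by apply: eq_bigr => i _; rewrite !upd_lt.
Qed.

Section Span.

Variables (K : closedFieldType) (V : lmodType K).
Implicit Types (e h : nat -> V) (u v w : V) (c : nat -> K).

Definition indep n e := forall c,
  \sum_(i < n) c i *: e i = 0 -> forall i, (i < n)%N -> c i = 0.

Definition inspan n e v := exists c, v = \sum_(i < n) c i *: e i.

Lemma inspan0 n e : inspan n e 0.
Proof. by exists (fun=> 0); rewrite big1 // => i _; rewrite scale0r. Qed.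

Lemma inspanP n e a u v : inspan n e u -> inspan n e v ->
  inspan n e (a *: u + v).
Proof.
move=> [c ->] [d ->]; exists (fun i => a * c i + d i).
rewrite scaler_sumr -big_split; apply: eq_bigr => i _ /=.
by rewrite scalerA scalerDl.
Qed.

Lemma inspan_sum n e m (a : nat -> K) (u : nat -> V) :
  (forall i, (i < m)%N -> inspan n e (u i)) ->
  inspan n e (\sum_(i < m) a i *: u i).
Proof.
elim: m => [|m IH] h; first by rewrite big_ord0; exact: inspan0.
rewrite big_ord_recr /= addrC; apply: inspanP; first exact: h.
by apply: IH => i lt; apply: h; exact: ltnW.
Qed.

Lemma inspan_basis n e i : (i < n)%N -> inspan n e (e i).
Proof.
move=> lt; exists (fun j => (j == i)%:R).
rewrite (bigD1 (Ordinal lt)) //= eqxx scale1r big1 ?addr0 // => j ne.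
by rewrite (_ : (j == i :> nat) = false) ?scale0r //; apply: contraNF ne.
Qed.

Lemma inspan_trans n e m h v : (forall i, (i < m)%N -> inspan n e (h i)) ->
  inspan m h v -> inspan n e v.
Proof. by move=> he [c ->]; exact: inspan_sum. Qed.

Lemma indep_inj n e c c' : indep n e ->
  \sum_(i < n) c i *: e i = \sum_(i < n) c' i *: e i ->
  forall i, (i < n)%N -> c i = c' i.
Proof.
move=> ind eqc i lt; apply/eqP; rewrite -subr_eq0; apply/eqP.
apply: (ind (fun i => c i - c' i)) lt.
rewrite (eq_bigr (fun i : 'I_n => c i *: e i - c' i *: e i)).
  by rewrite sumrB eqc subrr.
by move=> j _; rewrite scalerBl.
Qed.

Lemma indep_le m n e : (m <= n)%N -> indep n e -> indep m e.
Proof.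
move=> le ind c c0 i lt.
have := ind (fun i => if (i < m)%N then c i else 0).
move=> /(_ _ i (leq_trans lt le)); rewrite lt; apply.
rewrite -[RHS]c0 [RHS](big_ord_widen n (fun i => c i *: e i)) //.
rewrite [RHS]big_mkcond; apply: eq_bigr => j _.
by case: ifP => //; rewrite scale0r.
Qed.

Lemma indep_upd n e v : indep n e -> ~ inspan n e v -> indep n.+1 (upd n e v).
Proof.
move=> ind nv c; rewrite big_ord_recr /= upd_eq.
rewrite (eq_bigr (fun i : 'I_n => c i *: e i)); last first.
  by move=> i _; rewrite upd_lt.
move=> c0; have cn0 : c n = 0.
  apply/eqP; apply: contraT => cn; case: nv; exists (fun i => - (c n)^-1 * c i).
  apply: (scalerI cn); apply/eqP; rewrite scaler_sumr.
  rewrite (eq_bigr (fun i : 'I_n => - (c i *: e i))); last first.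
    by move=> i _; rewrite scalerA mulrA mulrN divff // mulN1r scaleNr.
  by rewrite sumrN -addr_eq0 addrC c0.
move=> i; rewrite ltnS leq_eqVlt => /orP[/eqP->//|]; apply: ind.
by rewrite -[RHS]c0 cn0 scale0r addr0.
Qed.

Lemma notin_span_lt n e i : indep n e -> (i < n)%N -> ~ inspan i e (e i).
Proof.
move=> ind lt [c e_i].
suff /(indep_le lt ind)/(_ i (ltnSn i))/eqP :
    \sum_(j < i.+1) upd i c (-1) j *: e j = 0.
  by rewrite upd_eq oppr_eq0 oner_eq0.
rewrite big_ord_recr /= upd_eq scaleN1r; apply/eqP; rewrite subr_eq0 e_i.
by apply/eqP/eq_bigr => j _; rewrite upd_lt.
Qed.

(** The coefficient matrix has more rows than columns, so a nonzero row vector kills it. *)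
Lemma too_many n (u : 'I_n.+1 -> V) h :
  (forall a : 'I_n.+1 -> K,
     \sum_(i < n.+1) a i *: u i = 0 -> forall i, a i = 0) ->
  ~ forall j, inspan n h (u j).
Proof.
move=> ind /choice[D uD].
pose M := \matrix_(j < n.+1, i < n) D j i.
have : kermx M != 0.
  by rewrite -mxrank_eq0 mxrank_ker -lt0n subn_gt0 ltnS rank_leq_col.
case/rowV0Pn => c /sub_kermxP cM /eqP; apply; apply/rowP => j; rewrite mxE.
apply: (ind (fun j => c 0 j)).
rewrite (eq_bigr (fun j => \sum_(i < n) (c 0 j * M j i) *: h i)); last first.
  move=> k _; rewrite uD scaler_sumr; apply: eq_bigr => i _.
  by rewrite scalerA mxE.
rewrite exchange_big big1 // => i _; rewrite -scaler_suml.
by have /rowP/(_ i) := cM; rewrite !mxE => ->; rewrite scale0r.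
Qed.

Definition catf n (h d : nat -> V) : nat -> V :=
  fun i => if (i < n)%N then h i else d (i - n)%N.

Lemma catf_l n h d i : (i < n)%N -> catf n h d i = h i.
Proof. by rewrite /catf => ->. Qed.

Lemma catf_r n h d i : catf n h d (n + i) = d i.
Proof. by rewrite /catf ltnNge leq_addr addKn. Qed.

Lemma exists_notin_span n h : infinite_dimensional V ->
  exists v, ~ inspan n h v.
Proof.
move=> /(_ n.+1)[u /(@too_many n u h) nin].
by apply: contra_notP nin => nin j; apply: contra_notP nin; exists (u j).
Qed.

End Span.

(** * Prescribing the values of a nondegenerate form *)

Section Form.

Variables (K : closedFieldType) (V : lmodType K) (B : {biscalar V}).
Variable k : form_kind.
Hypotheses (infV : infinite_dimensional V) (ndB : nondegenerate_form B).
Hypothesis kindB : form_of_kind k B.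
Hypothesis two_neq0 : 2%:R != 0 :> K.

Implicit Types (e h : nat -> V) (u v w : V) (c : nat -> K).

Lemma formDl u v w : B (u + v) w = B u w + B v w. Proof. exact: linearDl. Qed.
Lemma formDr u v w : B u (v + w) = B u v + B u w. Proof. exact: linearDr. Qed.
Lemma formZl a u v : B (a *: u) v = a * B u v. Proof. exact: linearZl_LR. Qed.
Lemma formZr a u v : B u (a *: v) = a * B u v. Proof. exact: linearZr_LR. Qed.
Lemma formNl u v : B (- u) v = - B u v. Proof. exact: linearNl. Qed.
Lemma form_sumr u n c e :
  B u (\sum_(i < n) c i *: e i) = \sum_(i < n) c i * B u (e i).
Proof. by rewrite linear_sumr; apply: eq_bigr => i _; rewrite formZr. Qed.
Lemma form_suml u n c e :
  B (\sum_(i < n) c i *: e i) u = \sum_(i < n) c i * B (e i) u.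
Proof. by rewrite linear_sumlz; apply: eq_bigr => i _; rewrite formZl. Qed.

Definition form_sign : bool :=
  if k is AlternatingForm then true else false.

Lemma form_sym u v : B u v = (-1) ^+ form_sign * B v u.
Proof.
move: kindB; rewrite /form_sign; case: k => [->|alt].
  by rewrite expr0 mul1r.
rewrite expr1 mulN1r; apply/eqP; rewrite -addr_eq0.
by have /eqP := alt (u + v); rewrite formDl !formDr !alt addr0 add0r.
Qed.

Lemma form_radical v : (forall u, B u v = 0) -> v = 0.
Proof. by move=> v0; apply: ndB => w; rewrite form_sym v0 mulr0. Qed.

(** By induction there is a family [d] dual to the first [n] vectors. Some vector orthogonal to
    these pairs nontrivially with [e n]; otherwise [e n] minus its expansion through [d] lies in the
    radical, and [e n] is in their span. *)
Lemma exists_form_values n e (z : nat -> K) : indep n e ->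
  exists u, forall i, (i < n)%N -> B u (e i) = z i.
Proof.
elim: n z => [|n IH] z ind; first by exists 0.
have {}IH y := IH y (indep_le (leqnSn n) ind).
have [d dE] := choice (fun j => IH (fun i => (i == j)%:R)).
have [u1 [u1e u1n]] :
    exists u1, (forall i, (i < n)%N -> B u1 (e i) = 0) /\ B u1 (e n) != 0.
  apply: contrapT => none; apply: (@notin_span_lt _ _ n.+1 e n ind) => //.
  exists (fun j => B (d j) (e n)); apply/eqP; rewrite -subr_eq0; apply/eqP.
  apply: form_radical => u; rewrite formDr -[X in _ + B u X]scaleN1r formZr.
  rewrite (form_sumr u n (fun j => B (d j) (e n)) e).
  (* [u'] is [u] corrected to be orthogonal to the first [n] vectors. *)
  pose u' := u - \sum_(j < n) B u (e j) *: d j.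
  have u'e w : B u' w = B u w - \sum_(j < n) B u (e j) * B (d j) w.
    by rewrite formDl formNl (form_suml w n (fun j => B u (e j)) d).
  have : B u' (e n) = 0.
    apply/eqP; apply: contra_notT none => u'n; exists u'; split=> // i lt.
    rewrite u'e (bigD1 (Ordinal lt)) //= dE // eqxx mulr1 big1 ?addr0 ?subrr //.
    move=> j ne; rewrite dE // (_ : (i == j :> nat) = false) ?mulr0 //.
    by apply: contraNF ne => /eqP ij; apply/eqP/val_inj.
  rewrite u'e mulN1r => u'n; rewrite -[RHS]u'n; congr (_ - _).
  by apply: eq_bigr => j _; rewrite mulrC.
have [u ue] := IH z.
exists (u + ((z n - B u (e n)) / B u1 (e n)) *: u1) => i.
rewrite ltnS leq_eqVlt formDl formZl => /orP[/eqP->|lt].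
  by rewrite divfK // addrC subrK.
by rewrite (u1e i) // mulr0 addr0 ue.
Qed.

Lemma exists_orthogonal n e m h : indep n e ->
  exists z, (forall i, (i < n)%N -> B z (e i) = 0) /\ ~ inspan m h z.
Proof.
move=> ind.
have [d dE] := choice (fun j =>
  exists_form_values (fun i => (i == j)%:R) ind).
(* [v] avoids the duals [d] as well, so correcting it by their combination leaves it outside the
   span of [h]. *)
have [v vn] := exists_notin_span (m + n) (catf m h d) infV.
exists (v - \sum_(j < n) B v (e j) *: d j); split=> [i lt|[c cE]].
  rewrite formDl formNl (form_suml (e i) n (fun j => B v (e j)) d).
  rewrite (bigD1 (Ordinal lt)) //= dE // eqxx mulr1.
  rewrite big1 ?addr0 ?subrr // => j ne; rewrite dE //.
  rewrite (_ : (i == j :> nat) = false) ?mulr0 //.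
  by apply: contraNF ne => /eqP ij; apply/eqP/val_inj.
apply: vn; move/eqP: cE; rewrite subr_eq => /eqP->.
rewrite -[X in inspan _ _ (X + _)]scale1r; apply: inspanP.
  apply: inspan_sum => i lt; rewrite -(catf_l h d lt); apply: inspan_basis.
  exact: ltn_addr.
apply: (@inspan_sum _ _ _ _ n (fun j => B v (e j))) => i lt.
have := @inspan_basis _ _ (m + n) (catf m h d) (m + i).
by rewrite catf_r ltn_add2l; apply.
Qed.

Lemma exists_values_notin n e (z : nat -> K) m h : indep n e ->
  exists u, (forall i, (i < n)%N -> B u (e i) = z i) /\ ~ inspan m h u.
Proof.
move=> ind; have [u uz] := exists_form_values z ind.
have [w [w0 wn]] := exists_orthogonal m h ind.
have [uh|] := pselect (inspan m h u); last by exists u.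
exists (w + u); split=> [i lt|h'].
  by rewrite formDl w0 // add0r uz.
by apply: wn; have := inspanP (-1) uh h'; rewrite scaleN1r addrC addrK.
Qed.

(** If [u] and [w] are both isotropic with [B u w = 1], then [u + w] has square 2; this is where
    characteristic 2 is excluded. *)
Lemma exists_anisotropic n e : k = SymmetricForm -> indep n e ->
  exists w, (forall i, (i < n)%N -> B w (e i) = 0) /\ B w w != 0.
Proof.
move=> kS ind; have [w [w0 wn]] := exists_orthogonal n e ind.
have sym u v : B u v = B v u by move: kindB; rewrite kS; apply.
have [u uE] := exists_form_values (upd n (fun=> 0) 1) (indep_upd ind wn).
have uw : B u w = 1 by have := uE n (ltnSn n); rewrite !upd_eq.
have ue i : (i < n)%N -> B u (e i) = 0.
  by move=> lt; have := uE i (leqW lt); rewrite !upd_lt.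
have [ww|ww] := eqVneq (B w w) 0; last by exists w.
have [uu|uu] := eqVneq (B u u) 0; last by exists u.
exists (u + w); split=> [i lt|]; first by rewrite formDl ue // w0 // addr0.
by rewrite formDl !formDr ww uu [B w u]sym uw addr0 add0r.
Qed.

(** In the symmetric case [v] runs along a line through [v0] in an anisotropic direction [w]
    orthogonal to all [e i]. The products stay constant, and the square is a quadratic polynomial in
    the parameter with leading coefficient [B w w], so it takes the value [t]. As [v0] avoids the
    span of [e] and [w], the line avoids that of [e]. *)
Lemma exists_vector n e (z : nat -> K) t : indep n e ->
  (k = AlternatingForm -> t = 0) ->
  exists v, [/\ ~ inspan n e v, forall i, (i < n)%N -> B v (e i) = z i &
    B v v = t].
Proof.
move=> ind tE; case kE: k; last first.
  have [v [vz vn]] := exists_values_notin z n e ind.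
  by exists v; split=> //; rewrite tE //; move: kindB; rewrite kE; apply.
have sym u v : B u v = B v u by move: kindB; rewrite kE; apply.
have [w [w0 ww]] := exists_anisotropic kE ind.
have [v0 [v0z v0n]] := exists_values_notin z n.+1 (upd n e w) ind.
pose p := Poly [:: B v0 v0 - t; 2%:R * B v0 w; B w w].
have [l /rootP pl] : exists l, root p l.
  by apply/closed_rootP; rewrite (@PolyK _ 0) //.
exists (l *: w + v0); split.
- move=> [c cE]; apply: v0n; exists (upd n c (- l)).
  by rewrite sum_upd -cE scaleNr addrC addKr.
- by move=> i lt; rewrite formDl formZl w0 // mulr0 add0r v0z.
move: pl; rewrite horner_Poly /= mul0r add0r formDl !formDr !formZl !formZr.
rewrite [B w v0]sym => /eqP; rewrite addrA subr_eq0 => /eqP<-.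
by ring.
Qed.

End Form.

(** * Substitution, automorphisms and saturation *)

Lemma dep_choice (I : Type) (T : I -> Type) (P : forall i, T i -> Prop) :
  (forall i, exists t, P i t) -> exists f, forall i, P i (f i).
Proof.
by move=> ex; exists (fun i => sval (cid (ex i))) => i; exact: svalP.
Qed.

Section Substitution.

Fixpoint tsubst (x y : ctx) (u : forall i : var x, term y (srt i)) s
    (t : term x s) : term y s :=
  match t in term _ s return term y s with
  | tvar i => u i
  | tzeroV => tzeroV y
  | tzeroK => tzeroK y
  | toneK => toneK y
  | taddV t1 t2 => taddV (tsubst u t1) (tsubst u t2)
  | taddK t1 t2 => taddK (tsubst u t1) (tsubst u t2)
  | tmulK t1 t2 => tmulK (tsubst u t1) (tsubst u t2)
  | tscale t1 t2 => tscale (tsubst u t1) (tsubst u t2)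
  | tform t1 t2 => tform (tsubst u t1) (tsubst u t2)
  end.

Definition tvarS (s : Defs.sort) (y : ctx) (i : var y) :
    term (s :: y) (srt i) :=
  @tvar (s :: y) (Some i).

Definition lift_subst (s : Defs.sort) (x y : ctx)
    (u : forall i : var x, term y (srt i)) (i : var (s :: x)) :
    term (s :: y) (srt i) :=
  match i return term (s :: y) (@srt (s :: x) i) with
  | Some j => tsubst (@tvarS s y) (u j)
  | None => @tvar (s :: y) None
  end.

Fixpoint fsubst (x : ctx) (phi : formula x) :
    forall y, (forall i : var x, term y (srt i)) -> formula y :=
  match phi with
  | ffalse => fun y _ => ffalse y
  | feq s t1 t2 => fun y u => feq (tsubst u t1) (tsubst u t2)
  | fimp phi1 phi2 => fun y u => fimp (fsubst phi1 u) (fsubst phi2 u)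
  | fall s phi1 => fun y u => fall (fsubst phi1 (@lift_subst s _ _ u))
  end.

Variables (K : closedFieldType) (V : lmodType K) (B : {biscalar V}).

Lemma teval_subst x y (u : forall i : var x, term y (srt i)) (a : tup V y) s
    (t : term x s) :
  teval B a (tsubst u t) = teval B (fun i => teval B a (u i)) t.
Proof. by elim: t => //= t1 -> t2 ->. Qed.

Lemma sat_subst x (phi : formula x) y (u : forall i : var x, term y (srt i))
    (a : tup V y) :
  sat B a (fsubst phi u) <-> sat B (fun i => teval B a (u i)) phi.
Proof.
elim: phi y u a => {x} [x|x s t1 t2|x p1 IH1 p2 IH2|x s p IH] y u a //=.
- by rewrite !teval_subst.
- by split=> h /IH1/h/IH2.
suff e d : (fun i : var (s :: x) => teval B (tup_cons d a) (@lift_subst s _ _ u i))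
    = tup_cons d (fun i => teval B a (u i)).
  by split=> h d; have := h d; rewrite IH e.
by apply: functional_extensionality_dep => -[j|] //=; rewrite teval_subst.
Qed.

End Substitution.

(** * Automorphisms, strong homogeneity for indexed families, and transcendental scalars *)

Section Automorphisms.

Variables (K : closedFieldType) (V : lmodType K) (B : {biscalar V}).

Definition selfmap := forall s, dom V s -> dom V s.

Definition act (g : selfmap) (x : ctx) (a : tup V x) : tup V x :=
  fun i => g _ (a i).

Lemma tup_cons_act (g : selfmap) s (x : ctx) (d : dom V s) (a : tup V x) :
  tup_cons (g s d) (act g a) = act g (tup_cons d a).
Proof. by apply: functional_extensionality_dep => -[]. Qed.

Lemma tup_cat_act (g : selfmap) (x y : ctx) (a : tup V x) (b : tup V y) :
  tup_cat (act g a) (act g b) = act g (tup_cat a b).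
Proof.
elim: x a => //= s x IH a.
rewrite (_ : tup_cat _ _ = act g (tup_cat (fun j : var x => a (Some j)) b)).
  exact: tup_cons_act.
exact: IH.
Qed.

Lemma teval_aut (g : selfmap) x (a : tup V x) s (t : term x s) :
  automorphism B g -> g s (teval B a t) = teval B (act g a) t.
Proof.
case=> _ gV gK g1 gDV gDK gM gZ gB.
by elim: t => //= [t1 <- t2 <-|t1 <- t2 <-|t1 <- t2 <-|t1 <- t2 <-|t1 <- t2 <-];
  rewrite ?gDV ?gDK ?gM ?gZ ?gB.
Qed.

Lemma aut_inj (g : selfmap) s : automorphism B g -> injective (g s).
Proof. by case=> bij *; exact: bij_inj (bij s). Qed.

Lemma sat_aut (g : selfmap) x (phi : formula x) (a : tup V x) :
  automorphism B g -> sat B a phi <-> sat B (act g a) phi.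
Proof.
move=> autg; elim: phi a => {x} [x|x s t1 t2|x p1 IH1 p2 IH2|x s p IH] a //=.
- by rewrite -!teval_aut //; split=> [->|/(aut_inj autg)].
- by rewrite (IH1 a) (IH2 a).
have [h hK Kh] := aut_bij autg s.
split=> p_d d; last by apply/IH; rewrite -tup_cons_act; exact: p_d.
by rewrite -[d]Kh tup_cons_act; apply: (IH _).1; exact: p_d.
Qed.

Lemma holds_aut (g : selfmap) x (phi : pformula V x) (a : tup V x) :
  automorphism B g ->
  holds B phi a <->
  holds B (PFormula (pform phi) (act g (pval (p := phi)))) (act g a).
Proof. by move=> autg; rewrite /holds /= tup_cat_act; exact: sat_aut. Qed.

Lemma aut_id : automorphism B (fun s d => d).
Proof. by split=> // s; exists id. Qed.

Lemma aut_comp (g h : selfmap) : automorphism B g -> automorphism B h ->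
  automorphism B (fun s d => g s (h s d)).
Proof.
move=> [gb gV gK g1 gDV gDK gM gZ gB] [hb hV hK h1 hDV hDK hM hZ hB].
split=> [s||||||||] /=; rewrite ?hV ?hK ?h1 //.
- exact: bij_comp (gb s) (hb s).
- by move=> u v; rewrite hDV gDV.
- by move=> u v; rewrite hDK gDK.
- by move=> u v; rewrite hM gM.
- by move=> u v; rewrite hZ gZ.
- by move=> u v; rewrite hB gB.
Qed.

Lemma aut_inv (g : selfmap) : automorphism B g ->
  exists h, [/\ automorphism B h, forall s, cancel (g s) (h s) &
    forall s, cancel (h s) (g s)].
Proof.
move=> autg; have inj s := @aut_inj g s autg.
case: autg => gb gV gK g1 gDV gDK gM gZ gB.
have /dep_choice[h0 h0E] : forall s, exists h : dom V s -> dom V s,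
    cancel (g s) h /\ cancel h (g s).
  by move=> s; have [h] := gb s; exists h.
exists h0.
have gh s : cancel (g s) (h0 s) by have [] := h0E s.
have hg s : cancel (h0 s) (g s) by have [] := h0E s.
split=> //; split=> [s||||||||].
- by exists (g s).
- by rewrite -[in LHS]gV gh.
- by rewrite -[in LHS]gK gh.
- by rewrite -[in LHS]g1 gh.
- by move=> u v; apply: (inj vec); rewrite gDV !hg.
- by move=> u v; apply: (inj sca); rewrite gDK !hg.
- by move=> u v; apply: (inj sca); rewrite gM !hg.
- by move=> u v; apply: (inj vec); rewrite gZ !hg.
- by move=> u v; apply: (inj sca); rewrite gB !hg.
Qed.

(** Indices act as names, and several may denote the same element; the formula for equality makes
    the induced map well defined. *)
Lemma hom_aut kappa (I : Defs.sort -> Type) (u u' : forall s, I s -> dom V s) :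
  strongly_homogeneous B kappa ->
  small kappa (fun d : elt V => exists i, u (projT1 d) i = projT2 d) ->
  (forall x (phi : formula x) (r : forall i : var x, I (srt i)),
     sat B (fun i => u _ (r i)) phi <-> sat B (fun i => u' _ (r i)) phi) ->
  exists2 g, automorphism B g & forall s i, g s (u s i) = u' s i.
Proof.
move=> homB smallI eqI.
have wd s (i j : I s) : u s i = u s j -> u' s i = u' s j.
  move=> eij; pose phi : formula [:: s; s] :=
    @feq _ s (@tvar [:: s; s] None) (@tvar [:: s; s] (Some None)).
  have /= [+ _] := eqI [:: s; s] phi (fun k : var [:: s; s] =>
    match k return I (@srt [:: s; s] k) with
    | None => i | Some None => j | Some (Some k) => match k with end end).
  exact.
have /dep_choice[F FE] : forall s, exists F : dom V s -> dom V s,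
    forall i, F (u s i) = u' s i.
  move=> s; suff /choice[F FE] :
      forall d, exists d', forall i, u s i = d -> u' s i = d'.
    by exists F => i; rewrite -(FE _ i).
  move=> d; have [[i <-]|none] := pselect (exists i, u s i = d).
    by exists (u' s i) => j /wd.
  by exists d => i e; case: none; exists i.
have elF : elementary_on B (fun d => exists i, u (projT1 d) i = projT2 d) F.
  move=> x phi a aI; pose r i : I (srt i) := sval (cid (aI i)).
  have rE i : u _ (r i) = a i := svalP (cid (aI i)).
  have -> : a = fun i => u _ (r i).
    by apply: functional_extensionality_dep => i.
  rewrite eqI (_ : (fun i => u' _ (r i)) = fun i => F _ (u _ (r i))) //.
  by apply: functional_extensionality_dep => i; rewrite FE.
have [g autg gF] := homB _ F smallI elF.
by exists g => // s i; rewrite gF ?FE //; exists i.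
Qed.

Definition tup_nil : tup V [::] :=
  fun i => match i as j return dom V (@srt [::] j) with end.

Section Small.

Variable kappa : Type.
Hypothesis kappa_uncountable : ~ countable [set: kappa].

Lemma countable_small (A : set (elt V)) : countable A -> small kappa A.
Proof.
move=> cA; split; last first.
  by move=> kA; apply: kappa_uncountable; exact: card_le_trans kA cA.
apply: card_le_trans cA _; apply/infiniteP => /finite_set_countable.
exact: kappa_uncountable.
Qed.

Hypothesis satB : saturated B kappa.

(** Arbitrary coefficients are not constants of the language, so they become entries of the
    parameter tuple [b]; the term is Horner's scheme. *)
Lemma poly_term (A : set (elt V)) (l : seq K) :
  (forall c, c \in l -> A (existT (dom V) sca c)) ->
  exists (y : ctx) (t : term (sca :: y) sca) (b : tup V y), tup_in A b /\
    forall d : K, teval B (tup_cons (d : dom V sca) b) t = (Poly l).[d].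
Proof.
elim: l => [|c l IH] lA.
  exists [::], (tzeroK _), tup_nil.
  by split=> [[]|d] /=; rewrite horner0.
have [|y [t [b [bA tE]]]] := IH.
  by move=> d dl; apply: lA; rewrite inE dl orbT.
pose u (i : var (sca :: y)) : term [:: sca, sca & y] (srt i) :=
  match i return term [:: sca, sca & y] (@srt (sca :: y) i) with
  | None => @tvar [:: sca, sca & y] None
  | Some j => @tvar [:: sca, sca & y] (Some (Some j))
  end.
exists (sca :: y), (taddK (tmulK (tsubst u t) (@tvar [:: sca, sca & y] None))
  (@tvar [:: sca, sca & y] (Some None))), (tup_cons (c : dom V sca) b).
split=> [[j|] /=|d /=].
- exact: bA.
- by apply: lA; rewrite inE eqxx.
rewrite teval_subst cons_poly_def hornerD hornerC hornerMX -tE.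
congr (_ * _ + _); congr (teval B _ t).
by apply: functional_extensionality_dep => -[].
Qed.

(** Saturation realises the type of a root of no nonzero [map_poly f P]: its parameters form a
    countable set, and finitely many conditions are met by a nonroot of a product. *)
Lemma exists_transcendental (S : countComNzRingType) (f : {rmorphism S -> K}) :
  exists c, transcendental f c.
Proof.
pose A : set (elt V) := range (fun r => existT (dom V) sca (f r)).
have /choice[phi phiE] (P : {poly S}) : exists phi : pformula V [:: sca],
    Defs.over A phi /\ forall a, holds B phi a <-> (map_poly f P).[a None] <> 0.
  have [|y [t [b [bA tE]]]] := @poly_term A (map_poly f P).
    move=> c /(nthP 0)[i _ <-]; rewrite coef_map; exact: imageT.
  exists (PFormula (fimp (feq (t : term ([:: sca] ++ y) sca) (tzeroK _))
    (ffalse _)) b); split=> // a.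
  by rewrite /holds /= tE polyseqK.
pose Sigma : set (pformula V [:: sca]) :=
  fun psi => exists2 P, map_poly f P != 0 & psi = phi P.
have smallA : small kappa A.
  apply: countable_small.
  exact: card_le_trans (card_image_le _ _) (countableP _).
have [_ [P _ ->]|n psi psiS|a aS] := @satB A [:: sca] Sigma smallA.
- by have [] := phiE P.
- have /choice[P PE] i : exists P, map_poly f P != 0 /\ psi i = phi P.
    by have [P] := psiS i; exists P.
  have : \prod_(i < n) map_poly f (P i) != 0.
    by apply/prodf_neq0 => i _; have [] := PE i.
  move=> /closed_nonrootP[c]; rewrite rootE horner_prod => /prodf_neq0 cE.
  exists (tup_cons (c : dom V sca) tup_nil) => i.
  by have [_ ->] := PE i; apply/(phiE _).2/eqP/cE.
exists (a None) => P Pa; apply/eqP; apply: contraT => P0.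
by case: ((phiE P).2 a).1 => //; apply: aS; exists P.
Qed.

End Small.

End Automorphisms.

(** * Back and forth *)

Fixpoint tup_nth (K : closedFieldType) (V : lmodType K) (x : ctx) :
    tup V x -> nat -> elt V :=
  match x return tup V x -> nat -> elt V with
  | [::] => fun _ _ => existT (dom V) sca (0 : K)
  | s :: x' => fun a n =>
      if n is n'.+1 then tup_nth (fun j : var x' => a (Some j)) n'
      else existT (dom V) s (a None)
  end.

Lemma tup_nthP (K : closedFieldType) (V : lmodType K) (x : ctx) (a : tup V x) i :
  exists n, tup_nth a n = existT (dom V) (srt i) (a i).
Proof.
elim: x a i => [a []|s x IH a [j|]] /=; last by exists 0%N.
by have [n <-] := IH (fun j => a (Some j)) j; exists n.+1.
Qed.

Lemma tup_cat_inj (K : closedFieldType) (V : lmodType K) (x y : ctx)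
    (a a' : tup V x) (b b' : tup V y) :
  tup_cat a b = tup_cat a' b' -> a = a' /\ b = b'.
Proof.
elim: x a a' => [|s x IH] a a' /=.
  by split=> //; apply: functional_extensionality_dep => -[].
move=> e.
have [|ea ->] := IH (fun j => a (Some j)) (fun j => a' (Some j)).
  apply: functional_extensionality_dep => i.
  exact: (congr1 (fun f : tup V (s :: x ++ y) => f (Some i)) e).
split=> //; apply: functional_extensionality_dep => -[j|].
  exact: (congr1 (fun f : tup V x => f j) ea).
exact: (congr1 (fun f : tup V (s :: x ++ y) => f None) e).
Qed.

Section BackAndForth.

Variables (K : closedFieldType) (V : lmodType K) (B : {biscalar V}).
Variable k : form_kind.
Hypotheses (infV : infinite_dimensional V) (ndB : nondegenerate_form B).
Hypothesis kindB : form_of_kind k B.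
Hypothesis two_neq0 : 2%:R != 0 :> K.
Variable kappa : Type.
Hypothesis kappa_uncountable : ~ countable [set: kappa].
Hypothesis satB : saturated B kappa.

(* A partial isomorphism: elements of a ring [st_R] name scalars, through
   [st_f] on the left and [st_f'] on the right, and finite sequences of them
   name the vectors with those coordinates. *)
Record state := State {
  st_R : countComNzRingType;
  st_f : {rmorphism st_R -> K};
  st_f' : {rmorphism st_R -> K};
  st_n : nat;
  st_e : nat -> V;
  st_e' : nat -> V;
  st_G : nat -> nat -> st_R;
  st_ker : same_kernel st_f st_f';
  st_ind : indep st_n st_e;
  st_ind' : indep st_n st_e';
  st_gram : forall i j, (i < st_n)%N -> (j < st_n)%N ->
    B (st_e i) (st_e j) = st_f (st_G i j);
  st_gram' : forall i j, (i < st_n)%N -> (j < st_n)%N ->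
    B (st_e' i) (st_e' j) = st_f' (st_G i j)
}.

Definition flip (st : state) : state :=
  State (same_kernel_sym (@st_ker st)) (@st_ind' st) (@st_ind st)
    (@st_gram' st) (@st_gram st).

Definition name (R : Type) (s : Defs.sort) : Type :=
  match s with vec => nat -> R | sca => R end.

Definition interp (R : Type) (f : R -> K) (n : nat) (e : nat -> V) s :
    name R s -> dom V s :=
  match s with
  | vec => fun r => \sum_(i < n) f (r i) *: e i
  | sca => f
  end.

Definition left (st : state) := @interp _ (@st_f st) (st_n st) (@st_e st).
Definition right (st : state) := @interp _ (@st_f' st) (st_n st) (@st_e' st).

Arguments left st {s} r.
Arguments right st {s} r.

Definition ext (st st1 : state) := exists h : st_R st -> st_R st1,
  [/\ forall r, @st_f st1 (h r) = @st_f st r,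
    forall r, @st_f' st1 (h r) = @st_f' st r, (st_n st <= st_n st1)%N,
    forall i, (i < st_n st)%N -> @st_e st1 i = @st_e st i &
    forall i, (i < st_n st)%N -> @st_e' st1 i = @st_e' st i].

Lemma ext_trans st1 st2 st3 : ext st1 st2 -> ext st2 st3 -> ext st1 st3.
Proof.
move=> [h [hf hf' hn he he']] [g [gf gf' gn ge ge']]; exists (g \o h).
split=> [r|r||i lt|i lt] /=; rewrite ?gf ?gf' ?hf ?hf' //.
- exact: leq_trans hn gn.
- by rewrite ge ?he //; exact: leq_trans lt hn.
- by rewrite ge' ?he' //; exact: leq_trans lt hn.
Qed.

Lemma ext_name st st1 : ext st st1 -> forall s (r : name (st_R st) s),
  exists r1 : name (st_R st1) s,
    left st1 r1 = left st r /\ right st1 r1 = right st r.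
Proof.
move=> [h [hf hf' hn he he']] [|] r; last by exists (h r) => /=; rewrite hf hf'.
exists (fun i => if (i < st_n st)%N then h (r i) else 0).
have widen (f1 f : _ -> K) (e1 e : nat -> V) : f1 0 = 0 ->
    (forall r, f1 (h r) = f r) -> (forall i, (i < st_n st)%N -> e1 i = e i) ->
    \sum_(i < st_n st1) f1 (if (i < st_n st)%N then h (r i) else 0) *: e1 i =
    \sum_(i < st_n st) f (r i) *: e i.
  move=> f0 fh ee; rewrite [RHS](big_ord_widen _ (fun i => f (r i) *: e i) hn).
  rewrite [RHS]big_mkcond; apply: eq_bigr => i _.
  by case: ifP => lt; rewrite ?f0 ?scale0r // fh ee.
by split; apply: widen; rewrite ?rmorph0.
Qed.

Lemma extend_scalar st (d : K) : exists st1 (r : st_R st1),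
  [/\ ext st st1, st_n st1 = st_n st, @st_e st1 = @st_e st,
    @st_e' st1 = @st_e' st & @st_f st1 r = d].
Proof.
have [d' dd'] : exists d', forall Q : {poly st_R st},
    (map_poly (@st_f st) Q).[d] = 0 <-> (map_poly (@st_f' st) Q).[d'] = 0.
  have [[P annP]|notalg] := pselect (exists P, annihilates (@st_f st) d P).
    exact: extend_algebraic (@st_ker st) annP.
  have [d' td'] := exists_transcendental kappa_uncountable satB (@st_f' st).
  exists d' => Q; split=> [Qd|/td'].
    have {}Qd : map_poly (@st_f st) Q = 0.
      by apply/eqP; apply: contra_notT notalg => Q0; exists Q.
    by rewrite (map_poly_ker (@st_ker st) Q).1 // horner0.
  by move=> /(map_poly_ker (@st_ker st) Q).2 ->; rewrite horner0.
pose R1 : countComNzRingType := {poly (st_R st)}.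
pose f1 : {rmorphism R1 -> K} := horner_morph (comm_morph (@st_f st) d).
pose f1' : {rmorphism R1 -> K} := horner_morph (comm_morph (@st_f' st) d').
have gram i j : (i < st_n st)%N -> (j < st_n st)%N ->
    B (@st_e st i) (@st_e st j) = f1 (@st_G st i j)%:P.
  by move=> lti ltj; rewrite /f1 /= horner_morphC; exact: st_gram.
have gram' i j : (i < st_n st)%N -> (j < st_n st)%N ->
    B (@st_e' st i) (@st_e' st j) = f1' (@st_G st i j)%:P.
  by move=> lti ltj; rewrite /f1' /= horner_morphC; exact: st_gram'.
(* [dd'] is, by computation, the equality of the kernels of evaluation at [d] and at [d']. *)
exists (@State R1 f1 f1' _ _ _ (fun i j => (@st_G st i j)%:P) dd'
  (@st_ind st) (@st_ind' st) gram gram'), ('X : {poly _}).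
split=> //=; last by rewrite /f1 /= horner_morphX.
by exists polyC; split=> // r; rewrite /= horner_morphC.
Qed.

Lemma extend_scalars st m (z : nat -> K) : exists st1 (r : nat -> st_R st1),
  [/\ ext st st1, st_n st1 = st_n st, @st_e st1 = @st_e st,
    @st_e' st1 = @st_e' st & forall i, (i < m)%N -> @st_f st1 (r i) = z i].
Proof.
elim: m => [|m [st1 [r [ext1 n1 e1 e1' rz]]]].
  by exists st, (fun=> 0); split=> //; exists id.
have [st2 [d [ext2 n2 e2 e2' dz]]] := extend_scalar st1 (z m).
have [h [hf _ _ _ _]] := ext2.
exists st2, (upd m (h \o r) d).
split; rewrite ?n2 ?e2 ?e2' //; first exact: ext_trans ext2.
move=> i; rewrite ltnS leq_eqVlt => /orP[/eqP->|lt]; first by rewrite upd_eq.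
by rewrite upd_lt //= hf rz.
Qed.

(** Outside the span, the products and the square of [v] are named first; a vector with the images
    of these names as its products and square then exists on the right. *)
Lemma extend_vector st (v : V) : exists st1 (r : nat -> st_R st1),
  ext st st1 /\ @left st1 vec r = v.
Proof.
have [[c cE]|vn] := pselect (inspan (st_n st) (@st_e st) v).
  have [st1 [r [ext1 n1 e1 _ rc]]] := extend_scalars st (st_n st) c.
  exists st1, r; split=> //; rewrite /left /= n1 e1 cE.
  by apply: eq_bigr => i _; rewrite rc.
(* The slot [st_n st], just past the basis, holds the square of [v]; hence the successor in the
   number of scalars. *)
pose z i := if (i < st_n st)%N then B v (@st_e st i) else B v v.
have [st1 [r [ext1 n1 e1 _ rz]]] := extend_scalars st (st_n st).+1 z.
set n := st_n st1; set f := @st_f st1; set f' := @st_f' st1.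
have rv i : (i < n)%N -> B v (@st_e st1 i) = f (r i).
  by rewrite /n n1 e1 => lt; rewrite /f rz ?leqW // /z lt.
have rvv : B v v = f (r n) by rewrite /f /n n1 rz // /z ltnn.
rewrite -n1 -e1 -/n in vn.
have [||v' [v'n v'e v'v]] := @exists_vector K V B k infV ndB kindB two_neq0 n
    (@st_e' st1) (fun i => f' (r i)) (f' (r n)).
- exact: st_ind'.
- move=> kA; apply/(@st_ker st1); rewrite -rvv.
  by move: kindB; rewrite kA; apply.
pose sg := (-1) ^+ form_sign k : st_R st1.
pose G i j := if i == n then r j else
  if j == n then sg * r i else @st_G st1 i j.
have gram (g : {rmorphism st_R st1 -> K}) (e : nat -> V) w :
    (forall i j, (i < n)%N -> (j < n)%N -> B (e i) (e j) = g (@st_G st1 i j)) ->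
    (forall i, (i < n)%N -> B w (e i) = g (r i)) -> B w w = g (r n) ->
    forall i j, (i < n.+1)%N -> (j < n.+1)%N ->
      B (upd n e w i) (upd n e w j) = g (G i j).
  move=> ge gw gww i j; rewrite !ltnS [in X in X -> _]leq_eqVlt /upd /G.
  case: eqVneq => [-> _|_ /= lti]; rewrite leq_eqVlt;
    case: eqVneq => [->|_ /= ltj] //; [exact: gw | move=> _ | exact: ge].
  rewrite (form_sym kindB) gw // rmorphM /sg rmorphXn rmorphN rmorph1.
  by [].
have ker1 := @st_ker st1.
exists (@State (st_R st1) f f' n.+1 (upd n (@st_e st1) v)
  (upd n (@st_e' st1) v') G ker1 (indep_upd (@st_ind st1) vn)
  (indep_upd (@st_ind' st1) v'n)
  (gram f _ _ (@st_gram st1) rv rvv) (gram f' _ _ (@st_gram' st1) v'e v'v)).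
exists (fun i => (i == n)%:R); split.
  apply: ext_trans ext1 _; exists id; split=> //= i lt; exact: upd_lt.
rewrite /left /= big_ord_recr /= eqxx rmorph1 scale1r upd_eq big1 ?add0r //.
by move=> i _; rewrite ltn_eqF // rmorph0 scale0r.
Qed.

Lemma extend_state st s (d : dom V s) : exists st1 (r : name (st_R st1) s),
  ext st st1 /\ left st1 r = d.
Proof.
case: s d => [v|c]; first exact: extend_vector.
by have [st1 [r [? _ _ _ ?]]] := extend_scalar st c; exists st1, r.
Qed.

Lemma term_name st x (r : forall i : var x, name (st_R st) (srt i)) s
    (t : term x s) : exists q : name (st_R st) s,
  left st q = teval B (fun i => left st (r i)) t /\
  right st q = teval B (fun i => right st (r i)) t.
Proof.
elim: t => /=.
- by move=> i; exists (r i).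
- by exists (fun=> 0); split; rewrite /left /right /= big1 // => i _;
    rewrite rmorph0 scale0r.
- by exists (0 : st_R st); rewrite /left /right /= !rmorph0.
- by exists (1 : st_R st); rewrite /left /right /= !rmorph1.
- move=> _ [q1 [<- <-]] _ [q2 [<- <-]].
  exists (fun i => q1 i + q2 i); split;
    by rewrite /left /right /= -big_split; apply: eq_bigr => i _ /=;
      rewrite rmorphD scalerDl.
- move=> _ [q1 [<- <-]] _ [q2 [<- <-]]; exists (q1 + q2 : st_R st).
  by rewrite /left /right /= !rmorphD.
- move=> _ [q1 [<- <-]] _ [q2 [<- <-]]; exists (q1 * q2 : st_R st).
  by rewrite /left /right /= !rmorphM.
- move=> _ [q1 [<- <-]] _ [q2 [<- <-]].
  exists (fun i => q1 * q2 i); split;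
    by rewrite /left /right /= scaler_sumr; apply: eq_bigr => i _ /=;
      rewrite rmorphM scalerA.
move=> _ [q1 [<- <-]] _ [q2 [<- <-]].
exists (\sum_(i < st_n st) q1 i * \sum_(j < st_n st) q2 j * @st_G st i j).
have gram (g : {rmorphism st_R st -> K}) (e : nat -> V) :
    (forall i j, (i < st_n st)%N -> (j < st_n st)%N ->
      B (e i) (e j) = g (@st_G st i j)) ->
    g (\sum_(i < st_n st) q1 i * \sum_(j < st_n st) q2 j * @st_G st i j) =
    B (\sum_(i < st_n st) g (q1 i) *: e i) (\sum_(i < st_n st) g (q2 i) *: e i).
  move=> ge; rewrite rmorph_sum (form_suml B _ _ (fun i => g (q1 i))).
  apply: eq_bigr => i _; rewrite rmorphM rmorph_sum; congr (_ * _).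
  rewrite (form_sumr B _ _ (fun i => g (q2 i))); apply: eq_bigr => j _.
  by rewrite rmorphM ge.
by split; apply: gram; [exact: st_gram | exact: st_gram'].
Qed.

Lemma name_inj st s (q1 q2 : name (st_R st) s) :
  left st q1 = left st q2 -> right st q1 = right st q2.
Proof.
case: s q1 q2 => q1 q2 /=; last exact: (same_kernel_eq _ _ (@st_ker st)).1.
move=> /(indep_inj (c := fun i => @st_f st (q1 i))
  (c' := fun i => @st_f st (q2 i)) (@st_ind st)) eq12.
apply: eq_bigr => i _; congr (_ *: _).
by apply: (same_kernel_eq _ _ (@st_ker st)).1; apply: eq12.
Qed.

(** A quantifier is met by extending the state with an arbitrary element on one side; the opposite
    side is the same step for the flipped state. *)
Lemma back_and_forth x (phi : formula x) st
    (r : forall i : var x, name (st_R st) (srt i)) :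
  sat B (fun i => left st (r i)) phi <-> sat B (fun i => right st (r i)) phi.
Proof.
elim: phi st r => {x} [x|x s t1 t2|x p1 IH1 p2 IH2|x s p IH] st r //=.
- have [q1 [<- <-]] := term_name r t1; have [q2 [<- <-]] := term_name r t2.
  by split; [exact: name_inj | exact: (@name_inj (flip st))].
- by rewrite IH1 IH2.
have cons_names st1 (d : name (st_R st1) s) : ext st st1 ->
    sat B (tup_cons (left st1 d) (fun i => left st (r i))) p <->
    sat B (tup_cons (right st1 d) (fun i => right st (r i))) p.
  move=> ext1.
  have /dep_choice[r1 r1E] := fun i => ext_name ext1 (r i).
  pose r2 (i : var (s :: x)) : name (st_R st1) (srt i) :=
    match i return name (st_R st1) (@srt (s :: x) i) with
    | Some j => r1 j
    | None => d
    end.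
  have := IH st1 r2.
  rewrite (_ : (fun i => left st1 (r2 i)) =
    tup_cons (left st1 d) (fun i => left st (r i))); last first.
    by apply: functional_extensionality_dep => -[j|] //=; have [] := r1E j.
  rewrite (_ : (fun i => right st1 (r2 i)) =
    tup_cons (right st1 d) (fun i => right st (r i))) //.
  by apply: functional_extensionality_dep => -[j|] //=; have [] := r1E j.
split=> p_d d.
  have [st1 [q [ext1 qd]]] := extend_state (flip st) d.
  have ext1' : ext st (flip st1) by have [h []] := ext1; exists h.
  by have [+ _] := cons_names (flip st1) q ext1'; rewrite [right _ _]qd; apply.
have [st1 [q [ext1 qd]]] := extend_state st d.
by have [_] := cons_names st1 q ext1; rewrite qd; apply.
Qed.

Hypothesis homB : strongly_homogeneous B kappa.

Lemma state_aut (st : state) : exists2 g, automorphism B g &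
  (forall r, g sca (@st_f st r) = @st_f' st r) /\
  (forall i, (i < st_n st)%N -> g vec (@st_e st i) = @st_e' st i).
Proof.
pose I s : Type := match s with vec => nat | sca => st_R st end.
pose nm s : I s -> name (st_R st) s :=
  match s with vec => fun i j => (j == i)%:R | sca => id end.
have nmE (f : {rmorphism st_R st -> K}) n (e : nat -> V) i : (i < n)%N ->
    @interp _ f n e vec (nm vec i) = e i.
  move=> lt /=; rewrite (bigD1 (Ordinal lt)) //= eqxx rmorph1 scale1r.
  rewrite big1 ?addr0 // => j ne; rewrite (_ : (j == i :> nat) = false).
    by rewrite rmorph0 scale0r.
  by apply: contraNF ne => /eqP ij; apply/eqP/val_inj.
have [|x phi r|g autg gE] := @hom_aut K V B kappa I
    (fun s i => left st (nm s i)) (fun s i => right st (nm s i)) homB.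
- apply: countable_small => //.
  pose F (i : nat + st_R st) : elt V := match i with
    | inl j => existT (dom V) vec (left st (nm vec j))
    | inr r => existT (dom V) sca (left st (nm sca r)) end.
  apply: (@card_le_trans _ _ _ (range F)); last first.
    exact: card_le_trans (card_image_le _ _) (countableP _).
  apply: subset_card_le => -[[] d] [i /= <-].
    by exists (inl i).
  by exists (inr i).
- exact: (@back_and_forth x phi st (fun i => nm _ (r i))).
exists g => //; split=> [r|i lt]; first exact: (gE sca r).
by have := gE vec i; rewrite /left /right !nmE.
Qed.

(** The names are the positions in the concatenation of [b] and [c], so strong homogeneity is
    applied to a finite set, although the types are compared over all of [A]. *)
Lemma same_type_aut (A : set (elt V)) (y z : ctx) (b b' : tup V y)
    (c : tup V z) : tup_in A c -> same_type_over B A b b' ->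
  exists g, [/\ automorphism B g, act g b = b' & act g c = c].
Proof.
move=> cA eqb; pose w := y ++ z.
pose a : tup V w := tup_cat b c; pose a' : tup V w := tup_cat b' c.
have eqa (phi : formula w) : sat B a phi <-> sat B a' phi.
  exact: (eqb (PFormula phi c)).
pose I s : Type := {i : var w | srt i = s}.
pose tm s (i : I s) : term w s :=
  let: exist j e := i in eq_rect _ (term w) (tvar j) s e.
have [|x phi r|g autg gE] := @hom_aut K V B kappa I
    (fun s i => teval B a (tm s i)) (fun s i => teval B a' (tm s i)) homB.
- apply: countable_small => //.
  apply: (@card_le_trans _ _ _ (range (tup_nth a))); last first.
    exact: card_le_trans (card_image_le _ _) (countableP _).
  apply: subset_card_le => -[s d] [[i si] /= <-]; rewrite /= in si *.
  clear d; case: s / si => /=; have [n <-] := tup_nthP a i; by exists n.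
(* Substitution turns a selection of positions, possibly with repetitions, into one formula about
   the whole tuple. *)
- rewrite -(sat_subst B phi (fun i => tm _ (r i)) a).
  rewrite -(sat_subst B phi (fun i => tm _ (r i)) a').
  exact: eqa.
have : act g a = a'.
  apply: functional_extensionality_dep => i.
  exact: (gE (srt i) (exist _ i erefl)).
rewrite -tup_cat_act => /tup_cat_inj[gb gc].
by exists g.
Qed.

End BackAndForth.

(** * Finite frames *)

Section Frames.

Variables (K : closedFieldType) (V : lmodType K) (B : {biscalar V}).

Lemma eq_tower_ev_fun (S : countComNzRingType) (R : comNzRingType)
    (f f' : {rmorphism S -> R}) z n (P : tower S n) :
  (forall r, f r = f' r) -> tower_ev f z n P = tower_ev f' z n P.
Proof.
move=> ff'; elim: n P => // n IH P; rewrite !tower_evS.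
by congr (_.[_]); exact: eq_map_poly.
Qed.

(* The range of [evZ N s] is the subring [Z[s_0, ..., s_(N-1)]]. *)
Definition evZ (N : nat) (s : nat -> K) : {rmorphism tower int N -> K} :=
  tower_ev (intr : {rmorphism int -> K}) s N.

Definition inZ N s c := exists r, c = evZ N s r.

Lemma inZ_var N s i : (i < N)%N -> inZ N s (s i).
Proof. by move=> lt; exists (towerX int N i); rewrite /evZ tower_evX. Qed.

Lemma inZ_add N s c d : inZ N s c -> inZ N s d -> inZ N s (c + d).
Proof. by move=> [r ->] [q ->]; exists (r + q); rewrite rmorphD. Qed.

Lemma inZ_mul N s c d : inZ N s c -> inZ N s d -> inZ N s (c * d).
Proof. by move=> [r ->] [q ->]; exists (r * q); rewrite rmorphM. Qed.

Lemma inZ_0 N s : inZ N s 0.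
Proof. by exists 0; rewrite rmorph0. Qed.

Lemma inZ_1 N s : inZ N s 1.
Proof. by exists 1; rewrite rmorph1. Qed.

Lemma inZ_sign N s (b : bool) : inZ N s ((-1) ^+ b).
Proof. by exists ((-1) ^+ b); rewrite rmorphXn rmorphN rmorph1. Qed.

Lemma evZ_factor N s N' s' : (forall i, (i < N)%N -> inZ N' s' (s i)) ->
  exists h : {rmorphism tower int N -> tower int N'},
    forall r, evZ N' s' (h r) = evZ N s r.
Proof.
move=> sN.
have /choice[p pE] i : exists p, (i < N)%N -> s i = evZ N' s' p.
  by case: (ltnP i N) => [/sN[p]|]; [exists p | exists 0].
exists (tower_ev (intr : {rmorphism int -> tower int N'}) p N) => r.
rewrite tower_ev_comp (eq_tower_ev_fun (f' := intr : {rmorphism int -> K})).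
  by apply: eq_tower_ev => i lt; rewrite pE.
by move=> z /=; rewrite rmorph_int.
Qed.

Lemma inZ_le N s N' s' c : (forall i, (i < N)%N -> inZ N' s' (s i)) ->
  inZ N s c -> inZ N' s' c.
Proof. by move=> /evZ_factor[h hE] [r ->]; exists (h r). Qed.

Lemma aut_rmorphism (g : selfmap V) : automorphism B g ->
  exists h : {rmorphism K -> K}, forall c, h c = g sca c.
Proof.
case=> _ _ g0 g1 _ gD gM _ _.
have addg : zmod_morphism (g sca : K -> K).
  move=> a b; apply/eqP; rewrite eq_sym subr_eq eq_sym -gD subrK eqxx //.
have mulg : monoid_morphism (g sca : K -> K) by split.
pose ga := GRing.isZmodMorphism.Build K K (g sca) addg.
pose gm := GRing.isMonoidMorphism.Build K K (g sca) mulg.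
pose h : {rmorphism K -> K} := HB.pack (g sca : K -> K) ga gm.
by exists h.
Qed.

Lemma evZ_aut (g : selfmap V) N s r : automorphism B g ->
  g sca (evZ N s r) = evZ N (fun i => g sca (s i)) r.
Proof.
move=> /aut_rmorphism[h hE]; rewrite -hE /evZ tower_ev_comp.
rewrite (eq_tower_ev_fun (f' := intr : {rmorphism int -> K})).
  by apply: eq_tower_ev => i _ /=; rewrite hE.
by move=> z /=; rewrite rmorph_int.
Qed.

Lemma inZ_aut (g : selfmap V) N s c : automorphism B g -> inZ N s c ->
  inZ N (fun i => g sca (s i)) (g sca c).
Proof. by move=> autg [r ->]; exists r; rewrite evZ_aut. Qed.

(** A finite set of parameters in normal form. The Gram condition makes the scalars of the ring
    generated by [fs], and the combinations of [fe] over it, closed under the form; a frame thus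
    presents a finitely generated substructure. *)
Record frame := Frame {
  fN : nat;
  fs : nat -> K;
  fn : nat;
  fe : nat -> V;
  fr_ind : indep fn fe;
  fr_gram : forall i j, (i < fn)%N -> (j < fn)%N ->
    inZ fN fs (B (fe i) (fe j))
}.

Definition scalar_in F := inZ (fN F) (fs F).

Definition vector_in F v := exists c : nat -> K,
  (forall i, (i < fn F)%N -> scalar_in F (c i)) /\
  v = \sum_(i < fn F) c i *: fe F i.

Definition named F s : dom V s -> Prop :=
  match s with vec => vector_in F | sca => scalar_in F end.
Arguments named F {s} d.

Definition fixes F (g : selfmap V) :=
  (forall i, (i < fN F)%N -> g sca (fs F i) = fs F i) /\
  (forall i, (i < fn F)%N -> g vec (fe F i) = fe F i).

Definition covers F' F :=
  (forall i, (i < fN F)%N -> scalar_in F' (fs F i)) /\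
  (forall i, (i < fn F)%N -> vector_in F' (fe F i)).

(** Unlike in [covers], the vectors of [F] form an initial segment of those of [F']: genericity of a
    vector treats the first [fn A] vectors apart from the rest. *)
Definition frame_le F F' := [/\ forall i, (i < fN F)%N -> scalar_in F' (fs F i),
  (fn F <= fn F')%N & forall i, (i < fn F)%N -> fe F' i = fe F i].

Lemma vector_in_basis F i : (i < fn F)%N -> vector_in F (fe F i).
Proof.
move=> lt; exists (fun j => (j == i)%:R); split.
  by move=> j _; case: (j == i); [exact: inZ_1 | exact: inZ_0].
rewrite (bigD1 (Ordinal lt)) //= eqxx scale1r big1 ?addr0 // => j ne.
by rewrite (_ : (j == i :> nat) = false) ?scale0r //; apply: contraNF ne.
Qed.

Lemma vector_in_sum F m (c : nat -> K) (u : nat -> V) :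
  (forall i, (i < m)%N -> scalar_in F (c i)) ->
  (forall i, (i < m)%N -> vector_in F (u i)) ->
  vector_in F (\sum_(i < m) c i *: u i).
Proof.
elim: m => [|m IH] hc hu.
  rewrite big_ord0; exists (fun=> 0); split=> [i _|]; first exact: inZ_0.
  by rewrite big1 // => i _; rewrite scale0r.
have [||d [dF dE]] := IH; [by move=> i /ltnW/hc | by move=> i /ltnW/hu |].
have [d' [dF' dE']] := hu m (ltnSn m).
exists (fun i => d i + c m * d' i); split=> [i lt|].
  apply: inZ_add; first exact: dF.
  by apply: inZ_mul; [exact: hc | exact: dF'].
rewrite big_ord_recr /= dE dE' scaler_sumr -big_split.
by apply: eq_bigr => i _ /=; rewrite scalerA scalerDl.
Qed.

Lemma covers_named F F' s (d : dom V s) : covers F' F -> named F d -> named F' d.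
Proof.
case=> ck cv; case: s d => [v [c [cF ->]]|c]; last exact: inZ_le.
by apply: vector_in_sum => // i /cF; exact: inZ_le.
Qed.

Lemma covers_trans F1 F2 F3 : covers F2 F1 -> covers F3 F2 -> covers F3 F1.
Proof.
move=> [ck cv] c32; split=> i lt.
  exact: (@covers_named F2 F3 sca _ c32 (ck i lt)).
exact: (@covers_named F2 F3 vec _ c32 (cv i lt)).
Qed.

Lemma frame_le_covers F F' : frame_le F F' -> covers F' F.
Proof.
case=> fk le fv; split=> // i lt; rewrite -fv //; apply: vector_in_basis.
exact: leq_trans lt le.
Qed.

Lemma frame_le_refl F : frame_le F F.
Proof. by split=> // i lt; exact: inZ_var. Qed.

Lemma frame_le_trans F1 F2 F3 : frame_le F1 F2 -> frame_le F2 F3 -> frame_le F1 F3.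
Proof.
move=> [k12 n12 e12] [k23 n23 e23]; split.
- by move=> i /k12; exact: inZ_le.
- exact: leq_trans n12 n23.
- by move=> i lt; rewrite e23 ?e12 //; exact: leq_trans lt n12.
Qed.

Lemma aut_sum (g : selfmap V) m (c : nat -> K) (e : nat -> V) :
  automorphism B g ->
  g vec (\sum_(i < m) c i *: e i) = \sum_(i < m) g sca (c i) *: g vec (e i).
Proof.
case=> _ g0 _ _ gD _ _ gZ _.
elim: m => [|m IH]; first by rewrite !big_ord0.
by rewrite !big_ord_recr /= gD IH gZ.
Qed.

Lemma fixes_named F g s (d : dom V s) : automorphism B g -> fixes F g ->
  named F d -> g s d = d.
Proof.
move=> autg [gk gv].
have gkn c : scalar_in F c -> g sca c = c.
  by move=> [r ->]; rewrite evZ_aut //; apply: eq_tower_ev.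
case: s d => [_ [c [cF ->]]|c] /=; last exact: gkn.
by rewrite aut_sum //; apply: eq_bigr => i _; rewrite gkn ?gv //; exact: cF.
Qed.

Lemma covers_fixes F F' g :
  automorphism B g -> covers F' F -> fixes F' g -> fixes F g.
Proof.
move=> autg [ck cv] fg; split=> i lt.
  exact: (@fixes_named F' g sca _ autg fg (ck i lt)).
exact: (@fixes_named F' g vec _ autg fg (cv i lt)).
Qed.

Lemma add_scalar F c : exists F', [/\ frame_le F F', scalar_in F' c, fn F' = fn F,
  fe F' = fe F & forall g, fixes F g -> g sca c = c -> fixes F' g].
Proof.
have le i : (i < fN F)%N -> inZ (fN F).+1 (upd (fN F) (fs F) c) (fs F i).
  by move=> lt; rewrite -(upd_lt _ c lt); apply: inZ_var; exact: leqW.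
have gram i j : (i < fn F)%N -> (j < fn F)%N ->
    inZ (fN F).+1 (upd (fN F) (fs F) c) (B (fe F i) (fe F j)).
  by move=> lti ltj; apply: inZ_le le _; exact: fr_gram.
exists (Frame (@fr_ind F) gram); split=> //.
  rewrite /scalar_in /= -[X in inZ _ _ X](upd_eq (fN F) (fs F) c).
  exact: inZ_var.
move=> g [gk gv] gc; split=> //= i; rewrite ltnS leq_eqVlt.
by move=> /orP[/eqP->|lt]; rewrite ?upd_eq // upd_lt // gk.
Qed.

Lemma add_scalars F m (z : nat -> K) : exists F', [/\ frame_le F F',
  forall i, (i < m)%N -> scalar_in F' (z i), fn F' = fn F, fe F' = fe F &
  forall g, fixes F g -> (forall i, (i < m)%N -> g sca (z i) = z i) -> fixes F' g].
Proof.
elim: m => [|m [F1 [le1 k1 n1 e1 g1]]].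
  by exists F; split=> //; exact: frame_le_refl.
have [F2 [le2 k2 n2 e2 g2]] := add_scalar F1 (z m); exists F2.
split; rewrite ?n2 ?e2 //; first exact: frame_le_trans le2.
  move=> i; rewrite ltnS leq_eqVlt => /orP[/eqP->//|/k1].
  by apply: inZ_le; have [] := le2.
by move=> g Fg gz; apply: g2 (gz m (ltnSn m)); apply: g1 => // i /ltnW/gz.
Qed.

Variable k : form_kind.
Hypothesis kindB : form_of_kind k B.

Lemma add_vector F v : ~ inspan (fn F) (fe F) v ->
  (forall i, (i < fn F)%N -> scalar_in F (B v (fe F i))) -> scalar_in F (B v v) ->
  exists F', [/\ frame_le F F', vector_in F' v &
    forall g, fixes F g -> g vec v = v -> fixes F' g].
Proof.
move=> vn vk vv.
have gram i j : (i < (fn F).+1)%N -> (j < (fn F).+1)%N ->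
    inZ (fN F) (fs F) (B (upd (fn F) (fe F) v i) (upd (fn F) (fe F) v j)).
  rewrite !ltnS [in X in X -> _]leq_eqVlt /upd.
  case: eqVneq => [-> _|_ /= lti]; rewrite leq_eqVlt;
    case: eqVneq => [->|_ /= ltj] //; [exact: vk | move=> _ | exact: fr_gram].
  by rewrite (form_sym kindB); apply: inZ_mul; [exact: inZ_sign | exact: vk].
pose F' := Frame (indep_upd (@fr_ind F) vn) gram.
have eE i : (i < fn F)%N -> fe F' i = fe F i by move=> lt; exact: upd_lt.
have ev : fe F' (fn F) = v by exact: upd_eq.
exists F'; split.
- by split=> [i lt||i lt]; [exact: inZ_var | exact: leqnSn | exact: eE].
- by rewrite -ev; exact: vector_in_basis.
move=> g [gk gv] gvv; split=> //= i; rewrite ltnS leq_eqVlt.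
by move=> /orP[/eqP->|lt]; rewrite ?upd_eq // upd_lt // gv.
Qed.

Lemma aut_inspan F g v : automorphism B g -> fixes F g ->
  inspan (fn F) (fe F) v -> inspan (fn F) (fe F) (g vec v).
Proof.
move=> autg [_ gv] [c ->]; exists (fun i => g sca (c i)).
by rewrite aut_sum //; apply: eq_bigr => i _; rewrite gv.
Qed.

(** The added scalars are coordinates or products of [d], which are fixed as soon as [F] and [d]
    are; the last clause records this, so that dividing over [F] and [d] becomes dividing over
    [F']. *)
Lemma add_elt F s (d : dom V s) : exists F', [/\ frame_le F F', named F' d &
  forall g, automorphism B g -> fixes F g -> g s d = d -> fixes F' g].
Proof.
case: s d => [v|c]; last first.
  have [F' [le kc _ _ gF]] := add_scalar F c; exists F'.
  by split=> // g _; exact: gF.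
have [[c cE]|vn] := pselect (inspan (fn F) (fe F) v).
  have [F' [le kc n' e' gF]] := add_scalars F (fn F) c.
  exists F'; split=> //.
    by exists c; rewrite n' e'.
  move=> g autg Fg gv; apply: gF => // i lt; have [_ ge] := Fg.
  apply: (@indep_inj _ _ (fn F) (fe F) (fun i => g sca (c i)) c (@fr_ind F)) => //.
  rewrite -cE -[in RHS]gv cE aut_sum //.
  by apply: eq_bigr => j _; rewrite ge.
pose z i := if (i < fn F)%N then B v (fe F i) else B v v.
have [F1 [le1 k1 n1 e1 g1]] := add_scalars F (fn F).+1 z.
have [|||F2 [le2 v2 g2]] := @add_vector F1 v.
- by rewrite n1 e1.
- move=> i; rewrite n1 e1 => lt; have := k1 i (leqW lt).
  by rewrite /z lt.
- by have := k1 (fn F) (ltnSn _); rewrite /z ltnn.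
exists F2; split=> //; first exact: frame_le_trans le1 le2.
move=> g autg Fg gv; apply: g2 => //; apply: g1 => // i _; rewrite /z.
have [_ ge] := Fg.
by case: ifP => lt; rewrite (aut_form autg) gv // ge.
Qed.

Lemma add_tup F x (a : tup V x) : exists F', [/\ frame_le F F',
  forall i, named F' (a i) &
  forall g, automorphism B g -> fixes F g -> (forall i, g _ (a i) = a i) ->
    fixes F' g].
Proof.
elim: x a F => [|s x IH] a F; first by exists F; split=> //; exact: frame_le_refl.
have [F1 [le1 a1 g1]] := IH (fun j => a (Some j)) F.
have [F2 [le2 a2 g2]] := add_elt F1 (a None : dom V s).
exists F2; split; first exact: frame_le_trans le1 le2.
  move=> [j|]; last exact: a2.
  exact: covers_named (frame_le_covers le2) (a1 j).
move=> g autg Fg ga; apply: g2 => //; last exact: (ga None).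
by apply: g1 => // i; exact: (ga (Some i)).
Qed.

Lemma cover_frame A F : exists C, frame_le A C /\ covers C F.
Proof.
have [C1 [le1 k1 _ _ _]] := add_scalars A (fN F) (fs F).
suff [C [leC cC]] : exists C, frame_le C1 C /\
    forall i, (i < fn F)%N -> vector_in C (fe F i).
  exists C; split; first exact: frame_le_trans leC.
  by split=> // i /k1; apply: inZ_le; have [] := leC.
elim: (fn F) => [|m [C [leC cC]]]; first by exists C1; split=> //; exact: frame_le_refl.
have [C' [leC' vC' _]] := add_elt C (fe F m : dom V vec).
exists C'; split; first exact: frame_le_trans leC'.
move=> i; rewrite ltnS leq_eqVlt => /orP[/eqP->//|/cC].
exact: (@covers_named C C' vec _ (frame_le_covers leC')).
Qed.

Lemma cover_frames A n (F : 'I_n -> frame) :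
  exists C, frame_le A C /\ forall i, covers C (F i).
Proof.
elim: n F => [|n IH] F; first by exists A; split=> [|[]] //; exact: frame_le_refl.
have [C [le cC]] := IH (fun i => F (lift ord0 i)).
have [C' [le' cC']] := cover_frame C (F ord0).
exists C'; split; first exact: frame_le_trans le'.
move=> i; case: (unliftP ord0 i) => [j ->|-> //].
exact: covers_trans (cC j) (frame_le_covers le').
Qed.

Lemma frame_map (g : selfmap V) F : automorphism B g ->
  exists F', [/\ fN F' = fN F, fs F' = (fun i => g sca (fs F i)), fn F' = fn F &
    fe F' = (fun i => g vec (fe F i))].
Proof.
move=> autg; have [h [auth gh hg]] := aut_inv autg.
have ind : indep (fn F) (fun i => g vec (fe F i)).
  move=> c c0; have := congr1 (h vec) c0.
  rewrite (@aut_sum h (fn F) c (fun i => g vec (fe F i)) auth) (aut_zeroV auth).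
  rewrite (eq_bigr (fun i : 'I_(fn F) => h sca (c i) *: fe F i)); last first.
    by move=> i _; rewrite gh.
  move=> /(@fr_ind F (fun i => h sca (c i))) hc i /hc e.
  by rewrite -[c i](hg sca) e (aut_zeroK autg).
have gram i j : (i < fn F)%N -> (j < fn F)%N ->
    inZ (fN F) (fun i => g sca (fs F i)) (B (g vec (fe F i)) (g vec (fe F j))).
  by move=> lti ltj; rewrite -(aut_form autg); apply: inZ_aut => //; exact: fr_gram.
by exists (Frame ind gram).
Qed.

End Frames.

(** * Generic elements and amalgamation *)

Section Dividing.

Variables (K : closedFieldType) (V : lmodType K) (B : {biscalar V}).
Variable k : form_kind.
Hypotheses (infV : infinite_dimensional V) (ndB : nondegenerate_form B).
Hypothesis kindB : form_of_kind k B.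
Hypothesis two_neq0 : 2%:R != 0 :> K.
Variable kappa : Type.
Hypothesis kappa_uncountable : ~ countable [set: kappa].
Hypothesis satB : saturated B kappa.
Hypothesis homB : strongly_homogeneous B kappa.

Let frame := frame B.

Lemma exists_generic (S : countComNzRingType) (f : {rmorphism S -> K}) n :
  exists z, generic f n z.
Proof.
elim: n => [|n [z gz]].
  by exists (fun=> 0) => P P0 z; rewrite -[RHS]P0.
have [c tc] :=
  exists_transcendental kappa_uncountable satB (tower_ev f z n).
exists (upd n z c).
have evE (P : tower S n) : tower_ev f (upd n z c) n P = tower_ev f z n P.
  by apply: eq_tower_ev => i lt; rewrite upd_lt.
apply: genericS => [P|P].
  by rewrite evE; exact: gz.
have -> : map_poly (tower_ev f (upd n z c) n) P = map_poly (tower_ev f z n) P.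
  exact: eq_map_poly.
by rewrite upd_eq; exact: tc.
Qed.

(* The unused arguments make the type match that of [gen_vector]. *)
Definition gen_scalar (N : nat) (s : nat -> K) (n : nat) (e : nat -> V)
    (c : K) := transcendental (evZ N s) c.

Section VectorGeneric.
Variables (m : nat) (v0 : V).

(* [v] is as free as its products with the first [m] vectors and its square
   allow: its products with the other vectors of the frame are algebraically
   independent. *)
Definition gen_vector (N : nat) (s : nat -> K) (n : nat) (e : nat -> V)
    (v : V) := [/\ ~ inspan n e v,
  forall i, (i < m)%N -> B v (e i) = B v0 (e i), B v v = B v0 v0 &
  generic (evZ N s) (n - m) (fun j => B v (e (m + j)%N))].

End VectorGeneric.

(** [Gen] takes raw data instead of a frame, so that it can be transported entry by entry along an
    automorphism. *)
Definition holds_on s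
  (Gen : nat -> (nat -> K) -> nat -> (nat -> V) -> dom V s -> Prop)
  (F : frame) := Gen (fN F) (fs F) (fn F) (fe F).

Lemma gen_scalar_exists (C : frame) : exists c, holds_on (s := sca) gen_scalar C c.
Proof. exact: (exists_transcendental kappa_uncountable satB (evZ _ _)). Qed.

(** The kernel of evaluation at a transcendental consists of the polynomials with killed
    coefficients. Evaluation at [c] and at [c'] therefore form a state that is the identity on
    [C]. *)
Lemma gen_scalar_uniq (C : frame) c c' :
  holds_on (s := sca) gen_scalar C c -> holds_on (s := sca) gen_scalar C c' ->
  exists g, [/\ automorphism B g, fixes C g & g sca c = c'].
Proof.
rewrite /holds_on /gen_scalar => tc tc'; set f := evZ (fN C) (fs C).
pose R1 : countComNzRingType := {poly (tower int (fN C))}.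
pose f1 d : {rmorphism R1 -> K} := horner_morph (comm_morph f d).
have f1C d r : f1 d r%:P = f r by rewrite /f1 /= horner_morphC.
have ker : same_kernel (f1 c) (f1 c').
  by move=> P; split=> [/tc|/tc'] P0; rewrite /f1 /= /horner_morph P0 horner0.
have /choice[G GE] (ij : nat * nat) : exists r, (ij.1 < fn C)%N ->
    (ij.2 < fn C)%N -> B (fe C ij.1) (fe C ij.2) = f r.
  case: (ltnP ij.1 (fn C)) => [lti|]; last by exists 0.
  case: (ltnP ij.2 (fn C)) => [ltj|]; last by exists 0.
  by have [r rE] := fr_gram lti ltj; exists r.
have gram d i j : (i < fn C)%N -> (j < fn C)%N ->
    B (fe C i) (fe C j) = f1 d (G (i, j))%:P.
  by move=> lti ltj; rewrite f1C -GE.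
have [g autg [gk gv]] := state_aut infV ndB kindB two_neq0 kappa_uncountable
  satB homB (@State K V B R1 (f1 c) (f1 c') (fn C) (fe C) (fe C)
    (fun i j => (G (i, j))%:P) ker (@fr_ind _ _ _ C) (@fr_ind _ _ _ C)
    (gram c) (gram c')).
rewrite /= in gk gv; exists g; split=> //; last first.
  by have := gk 'X; rewrite !horner_morphX.
split=> // i /(@inZ_var _ _ (fs C))[r ->].
by have := gk r%:P; rewrite !horner_morphC.
Qed.

Lemma gen_scalar_mono (C C' : frame) c : covers C' C ->
  holds_on (s := sca) gen_scalar C' c -> holds_on (s := sca) gen_scalar C c.
Proof.
move=> [/evZ_factor[h hE] _] tc P.
have -> : map_poly (evZ (fN C) (fs C)) P =
    map_poly (evZ (fN C') (fs C')) (map_poly h P).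
  by rewrite -map_poly_comp; apply: eq_map_poly => r /=; rewrite hE.
exact: tc.
Qed.

Lemma gen_scalar_aut N s n e c g : automorphism B g ->
  gen_scalar N s n e c ->
  gen_scalar N (fun i => g sca (s i)) n (fun i => g vec (e i)) (g sca c).
Proof.
rewrite /gen_scalar => autg tc P; have [h hE] := aut_rmorphism autg.
have -> : map_poly (evZ N (fun i => g sca (s i))) P =
    map_poly h (map_poly (evZ N s) P).
  rewrite -map_poly_comp; apply: eq_map_poly => r /=.
  by rewrite hE (evZ_aut s r autg).
rewrite -hE horner_map hE => /eqP; rewrite -(aut_zeroK autg).
by move=> /eqP/(aut_inj (s := sca) autg) P0; rewrite (tc P P0) rmorph0.
Qed.

(** * Generic vectors with prescribed square and prescribed products with a frame *)

Section GenVector.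
Variables (A : frame) (v0 : V).
Hypothesis v0A : forall i, (i < fn A)%N -> inZ (fN A) (fs A) (B v0 (fe A i)).
Hypothesis v00 : inZ (fN A) (fs A) (B v0 v0).

Let Gen := gen_vector (fn A) v0.

Lemma gen_vector_exists C : frame_le A C -> exists v, holds_on (s := vec) Gen C v.
Proof.
move=> leAC; have [z gz] := exists_generic (evZ (fN C) (fs C)) (fn C - fn A).
pose y i := if (i < fn A)%N then B v0 (fe C i) else z (i - fn A)%N.
have alt : k = AlternatingForm -> B v0 v0 = 0.
  by move=> kA; move: kindB; rewrite kA; apply.
have [v [vn vy vv]] :=
  exists_vector infV ndB kindB two_neq0 y (@fr_ind _ _ _ C) alt.
have le : (fn A <= fn C)%N by case: leAC.
exists v; split=> // [i lt|].
  by rewrite vy /y ?lt //; exact: leq_trans lt le.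
move=> P; rewrite (@eq_tower_ev _ _ _ _ (z)); first exact: gz.
move=> j; rewrite ltn_subRL => lt.
by rewrite vy // /y ltnNge leq_addr addKn.
Qed.

(** The variables of [R1] name the products with vectors beyond [A], and genericity gives both
    evaluations the same kernel. The square and the products with [A] already have names among the
    scalars of [C]. *)
Lemma gen_vector_uniq C v v' : frame_le A C ->
  holds_on (s := vec) Gen C v -> holds_on (s := vec) Gen C v' ->
  exists g, [/\ automorphism B g, fixes C g & g vec v = v'].
Proof.
move=> leAC [vn vA vv gv] [v'n v'A v'v gv'].
have [leK len leE] := leAC.
set f := evZ (fN C) (fs C) in gv gv'; set d := (fn C - fn A)%N in gv gv'.
pose R1 : countComNzRingType := tower (tower int (fN C)) d.
pose th w j := B w (fe C (fn A + j)%N).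
pose f1 w : {rmorphism R1 -> K} := tower_ev f (th w) d.
have f1C w r : f1 w (towerC _ d r) = f r by exact: tower_evC.
have ker : same_kernel (f1 v) (f1 v') by exact: generic_same_kernel.
have /choice[G GE] (ij : nat * nat) : exists r, (ij.1 < fn C)%N ->
    (ij.2 < fn C)%N -> B (fe C ij.1) (fe C ij.2) = f r.
  case: (ltnP ij.1 (fn C)) => [lti|]; last by exists 0.
  case: (ltnP ij.2 (fn C)) => [ltj|]; last by exists 0.
  by have [r rE] := fr_gram lti ltj; exists r.
have /choice[G0 G0E] i : exists r, (i < fn A)%N -> B v0 (fe C i) = f r.
  case: (ltnP i (fn A)) => [lt|]; last by exists 0.
  have [r rE] : scalar_in C (B v0 (fe C i)).
    by rewrite leE //; exact: inZ_le (v0A lt).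
  by exists r.
have [r00 r00E] : scalar_in C (B v0 v0) by exact: inZ_le v00.
pose r i : R1 := if (i < fn A)%N then towerC _ d (G0 i)
  else towerX _ d (i - fn A)%N.
have wE w : (forall i, (i < fn A)%N -> B w (fe C i) = B v0 (fe C i)) ->
    forall i, (i < fn C)%N -> B w (fe C i) = f1 w (r i).
  move=> wA i lt; rewrite /r; case: ltnP => [lti|lei].
    by rewrite f1C wA // G0E.
  rewrite /f1 tower_evX; first by rewrite /th subnKC.
  by rewrite ltn_sub2r //; exact: leq_ltn_trans lei lt.
pose sg : R1 := (-1) ^+ form_sign k.
pose G1 i j : R1 :=
  if i == fn C then (if j == fn C then towerC _ d r00 else r j) else
  if j == fn C then sg * r i else towerC _ d (G (i, j)).
have gram w : (forall i, (i < fn A)%N -> B w (fe C i) = B v0 (fe C i)) ->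
    B w w = B v0 v0 ->
    forall i j, (i < (fn C).+1)%N -> (j < (fn C).+1)%N ->
    B (upd (fn C) (fe C) w i) (upd (fn C) (fe C) w j) = f1 w (G1 i j).
  move=> wA ww i j; rewrite !ltnS [in X in X -> _]leq_eqVlt /upd /G1.
  case: eqVneq => [-> _|_ /= lti]; rewrite leq_eqVlt;
    case: eqVneq => [->|_ /= ltj] //.
  - by rewrite f1C ww.
  - by rewrite wE.
  - move=> _; rewrite (form_sym kindB) wE // rmorphM.
    by rewrite /sg rmorphXn rmorphN rmorph1.
  - by rewrite f1C -GE.
have [g autg [gk ge]] := state_aut infV ndB kindB two_neq0 kappa_uncountable
  satB homB (@State K V B R1 (f1 v) (f1 v') (fn C).+1
    (upd (fn C) (fe C) v) (upd (fn C) (fe C) v') G1 ker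
    (indep_upd (@fr_ind _ _ _ C) vn) (indep_upd (@fr_ind _ _ _ C) v'n)
    (gram v vA vv) (gram v' v'A v'v)).
rewrite /= in gk ge; exists g; split=> //; last first.
  by have := ge _ (ltnSn (fn C)); rewrite !upd_eq.
split=> i; last by move=> lt; have := ge i (leqW lt); rewrite !upd_lt.
move=> /(@inZ_var _ _ (fs C))[q ->].
by have := gk (towerC _ d q); rewrite !f1C.
Qed.

(* The products of [v] with the vectors of [C] are the image of those with the
   vectors of [C'] under an affine map over the scalars of [C'], which is
   surjective because every prescribed list of products with independent
   vectors is realised. *)
Lemma gen_vector_mono C C' v : frame_le A C -> frame_le A C' -> covers C' C ->
  holds_on (s := vec) Gen C' v -> holds_on (s := vec) Gen C v.
Proof.
move=> leAC leAC' cov [vn vA vv gv].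
have [leK len leE] := leAC; have [leK' len' leE'] := leAC'.
have [/evZ_factor[h hE] cv] := cov.
have vA' i : (i < fn A)%N -> B v (fe C i) = B v0 (fe C i).
  by move=> lt; rewrite leE // -(leE' _ lt) vA.
split=> //.
  move=> vin; apply: vn; apply: inspan_trans vin => i /cv[c [_ ->]].
  by exists c.
set d := (fn C - fn A)%N; set d' := (fn C' - fn A)%N in gv.
set f' := evZ (fN C') (fs C') in hE gv.
pose R' := tower (tower int (fN C')) d'.
(* The affine map, as a list of polynomials. *)
have /choice[y yE] j : exists y : R', (j < d)%N -> forall u,
    (forall i, (i < fn A)%N -> B u (fe A i) = B v0 (fe A i)) ->
    tower_ev f' (fun l => B u (fe C' (fn A + l)%N)) d' y =
    B u (fe C (fn A + j)%N).
  case: (ltnP j d) => [lt|]; last by exists 0.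
  have [|c [cC' cE]] := cv (fn A + j)%N; first by rewrite -ltn_subRL.
  have /choice[a aE] i : exists a : R', (i < fn C')%N -> forall u,
      (forall i, (i < fn A)%N -> B u (fe A i) = B v0 (fe A i)) ->
      tower_ev f' (fun l => B u (fe C' (fn A + l)%N)) d' a =
      c i * B u (fe C' i).
    case: (ltnP i (fn C')) => [lti|]; last by exists 0.
    have [q qE] := cC' i lti.
    case: (ltnP i (fn A)) => [ltiA|leiA].
      have [q0 q0E] : scalar_in C' (B v0 (fe A i)) by exact: inZ_le (v0A ltiA).
      exists (towerC _ d' (q * q0)) => _ u uA.
      by rewrite tower_evC rmorphM leE' // uA // q0E qE.
    exists (towerC _ d' q * towerX _ d' (i - fn A)%N) => _ u uA.
    rewrite rmorphM tower_evC tower_evX; last first.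
      by rewrite ltn_sub2r //; exact: leq_ltn_trans leiA lti.
    by rewrite subnKC // qE.
  exists (\sum_(i < fn C') a i) => _ u uA.
  rewrite cE (form_sumr B u (fn C') c (fe C')) rmorph_sum.
  by apply: eq_bigr => i _; rewrite aE.
pose sub : {rmorphism tower (tower int (fN C)) d -> R'} :=
  tower_ev (towerC (tower int (fN C')) d' \o h)%FUN y d.
have subE P u : (forall i, (i < fn A)%N -> B u (fe A i) = B v0 (fe A i)) ->
    tower_ev f' (fun l => B u (fe C' (fn A + l)%N)) d' (sub P) =
    tower_ev (evZ (fN C) (fs C)) (fun j => B u (fe C (fn A + j)%N)) d P.
  move=> uA; rewrite /sub tower_ev_comp.
  rewrite (eq_tower_ev_fun (f' := evZ (fN C) (fs C))); last first.
    by move=> q /=; rewrite tower_evC hE.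
  by apply: eq_tower_ev => j lt /=; rewrite yE.
move=> P P0 z.
pose w i := if (i < fn A)%N then B v0 (fe A i) else z (i - fn A)%N.
have [u uw] := exists_form_values ndB kindB w (@fr_ind _ _ _ C).
have uA i : (i < fn A)%N -> B u (fe A i) = B v0 (fe A i).
  by move=> lt; rewrite -{1}leE // uw /w ?lt //; exact: leq_trans lt len.
have vAA i : (i < fn A)%N -> B v (fe A i) = B v0 (fe A i).
  by move=> lt; rewrite -leE // vA'.
rewrite -(@eq_tower_ev _ _ _ (fun j => B u (fe C (fn A + j)%N))); last first.
  move=> j; rewrite ltn_subRL => lt.
  by rewrite uw // /w ltnNge leq_addr addKn.
rewrite -subE //; apply: gv; rewrite -[RHS]P0; exact: subE.
Qed.

End GenVector.

Lemma gen_vector_aut m v0 N s n e v g : automorphism B g ->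
  (forall i, (i < m)%N -> g sca (B v0 (e i)) = B v0 (g vec (e i))) ->
  g sca (B v0 v0) = B v0 v0 ->
  gen_vector m v0 N s n e v ->
  gen_vector m v0 N (fun i => g sca (s i)) n (fun i => g vec (e i)) (g vec v).
Proof.
move=> autg ge g0 [vn ve vv gv].
have [g' [autg' gg' g'g]] := aut_inv autg.
split.
- move=> [c cE]; apply: vn; exists (fun i => g' sca (c i)).
  apply: (aut_inj (s := vec) autg).
  rewrite cE (aut_sum n (fun i => g' sca (c i)) e autg).
  by apply: eq_bigr => i _; rewrite g'g.
- by move=> i lt; rewrite -(aut_form autg) ve // ge.
- by rewrite -(aut_form autg) vv.
have [h hE] := aut_rmorphism autg.
have evE (P : tower (tower int N) (n - m)) z :
    tower_ev (evZ N (fun i => g sca (s i))) (fun j => g sca (z j)) (n - m) P =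
    g sca (tower_ev (evZ N s) z (n - m) P).
  rewrite -hE tower_ev_comp (eq_tower_ev_fun
    (f' := evZ N (fun i => g sca (s i)))); last first.
    by move=> r /=; rewrite hE (evZ_aut s r autg).
  by apply: eq_tower_ev => i _ /=; rewrite hE.
move=> P.
rewrite (@eq_tower_ev _ _ _ _ (fun j => g sca (B v (e (m + j)%N)))); last first.
  by move=> j _; rewrite -(aut_form autg).
rewrite evE => /eqP; rewrite -(aut_zeroK autg).
move=> /eqP/(aut_inj (s := sca) autg) P0 z.
have {}P0 := gv P P0.
rewrite (@eq_tower_ev _ _ _ _ (fun j => g sca (g' sca (z j)))); last first.
  by move=> j _; rewrite g'g.
by rewrite evE P0 (aut_zeroK autg).
Qed.

(* Dividing over the group [P] of automorphisms; only finite pieces of an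
   inconsistent sequence of conjugates are retained. *)
Definition divides_under (P : selfmap V -> Prop) x (D : tup V x -> Prop) :=
  exists l, forall n, exists g : 'I_n -> selfmap V,
    (forall i, automorphism B (g i) /\ P (g i)) /\
    forall h : 'I_l -> 'I_n, injective h ->
      ~ exists a, forall j, D (act (g (h j)) a).

Definition invariant_under (P : selfmap V -> Prop) x (D : tup V x -> Prop) :=
  forall g, automorphism B g -> P g -> forall a, D (act g a) -> D a.

Lemma divides_underS (P Q : selfmap V -> Prop) x (D : tup V x -> Prop) :
  (forall g, automorphism B g -> P g -> Q g) ->
  divides_under P D -> divides_under Q D.
Proof.
move=> PQ [l lD]; exists l => n; have [g [gP gD]] := lD n.
by exists g; split=> // i; have [? ?] := gP i; split=> //; exact: PQ.
Qed.

(** The automorphisms [q i] that witness dividing pull [C] back to frames [Ci i]. If [e2] is generic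
    over all of these, [q i] sends it to an element generic over [C], which some [h i] fixing [C]
    sends to [e1]. With [p] moving [e1] to [e2] over [A], the composite of [p], [q i] and [h i]
    fixes both [A] and [e1]. Since [h i] fixes [Cb], it does not affect [D], and inconsistency is
    inherited from the [q i]. *)
Lemma amalgamation (A Cb : frame) s
    (Gen : nat -> (nat -> K) -> nat -> (nat -> V) -> dom V s -> Prop)
    (e0 : dom V s) :
  (forall C, frame_le A C -> exists e, holds_on Gen C e) ->
  (forall C e e', frame_le A C -> holds_on Gen C e -> holds_on Gen C e' ->
     exists g, [/\ automorphism B g, fixes C g & g s e = e']) ->
  (forall C C' e, frame_le A C -> frame_le A C' -> covers C' C ->
     holds_on Gen C' e -> holds_on Gen C e) ->
  (forall g N t n e d, automorphism B g -> fixes A g ->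
     (forall i, (i < fn A)%N -> e i = fe A i) -> Gen N t n e d ->
     Gen N (fun i => g sca (t i)) n (fun i => g vec (e i)) (g s d)) ->
  holds_on Gen A e0 ->
  exists g, [/\ automorphism B g, fixes A g &
    forall x (D : tup V x -> Prop), invariant_under (fixes Cb) D ->
      divides_under (fixes A) D ->
      divides_under (fun q => fixes A q /\ q s (g s e0) = g s e0) D].
Proof.
move=> ex uniq mono gaut ge0.
have [C [leAC CCb]] := cover_frame kindB A Cb.
have [e1 ge1] := ex C leAC.
have ge1A : holds_on Gen A e1.
  exact: mono (frame_le_refl A) leAC (frame_le_covers leAC) ge1.
have [g [autg gA ge]] := uniq A e0 e1 (frame_le_refl A) ge0 ge1A.
exists g; split=> // x D invD [l lD]; exists l => n; rewrite ge.
have [q [qP qD]] := lD n.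
have /choice[Ci CiP] i : exists Ci : frame, [/\ frame_le A Ci &
    forall e, holds_on Gen Ci e -> holds_on Gen C (q i s e)].
  have [autq qA] := qP i; have [h [auth qh hq]] := aut_inv autq.
  have hA : fixes A h.
    have [qk qv] := qA.
    by split=> j lt; [rewrite -{1}(qk j lt) qh | rewrite -{1}(qv j lt) qh].
  have [F [FN Fs Fn Fe]] := frame_map C auth.
  have leAF : frame_le A F.
    have [leK len leE] := leAC; split=> [j lt||j lt]; rewrite ?Fn //.
      have := inZ_aut auth (leK j lt).
      by rewrite hA.1 // /scalar_in FN Fs.
    by rewrite Fe leE // hA.2.
  exists F; split=> // e; rewrite /holds_on FN Fs Fn Fe =>
    /(gaut _ _ _ _ _ _ autq qA) h1.
  have /h1 : forall j, (j < fn A)%N -> h vec (fe C j) = fe A j.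
    by have [_ _ leE] := leAC; move=> j lt; rewrite leE // hA.2.
  rewrite (_ : (fun i0 => q i sca (h sca (fs C i0))) = fs C).
    rewrite (_ : (fun i0 => q i vec (h vec (fe C i0))) = fe C) //.
    by apply/funext => j; rewrite hq.
  by apply/funext => j; rewrite hq.
have [C' [leAC' covC']] := cover_frames kindB A Ci.
have [e2 ge2] := ex C' leAC'.
have /choice[h hP] i : exists h, [/\ automorphism B h, fixes C h &
    h s (q i s e2) = e1].
  have [leACi CiC] := CiP i; apply: uniq => //; apply: CiC.
  exact: mono leACi leAC' (covC' i) ge2.
have [p [autp pA pe]] := uniq A e1 e2 (frame_le_refl A) ge1A
  (mono A C' e2 (frame_le_refl A) leAC' (frame_le_covers leAC') ge2).
exists (fun i t d => h i t (q i t (p t d))); split=> [i|f injf].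
  have [autq qA] := qP i; have [auth hC he] := hP i; split.
    exact: aut_comp auth (aut_comp autq autp).
  have hA := covers_fixes auth (frame_le_covers leAC) hC.
  split; last by rewrite pe he.
  by split=> j lt; rewrite ?pA.1 ?qA.1 ?hA.1 // pA.2 // qA.2 // hA.2.
move=> [a aD]; apply: (qD f injf); exists (act p a) => j.
have [auth hC _] := hP (f j).
exact: invD auth (covers_fixes auth CCb hC) _ (aD j).
Qed.

End Dividing.

(** * Absorbing a realisation *)

(** If the fibre over the first value is small, removing it leaves enough indices for the other
    values. *)
Lemma pigeonhole (T : eqType) (rs : seq T) (I : finType) (f : I -> T) n
    (A : {set I}) :
  (forall i, i \in A -> f i \in rs) -> (size rs * n < #|A|)%N ->
  exists z (h : 'I_n.+1 -> I), injective h /\ forall i, f (h i) = z.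
Proof.
elim: rs A => [|z rs IH] A fA.
  by rewrite mul0n => /card_gt0P[i /fA].
rewrite /= mulSn => ltA; pose F := [set i in A | f i == z].
have [leF|ltF] := leqP #|F| n.
  apply: (IH (A :\: F)) => [i|].
    rewrite !inE negb_and => /andP[/orP[/negP//|ne] iA].
    by have := fA i iA; rewrite inE (negPf ne).
  have sFA : F \subset A by apply/fintype.subsetP => i; rewrite inE => /andP[].
  rewrite cardsD (finset.setIidPr sFA) ltn_subRL; apply: leq_ltn_trans ltA.
  by rewrite leq_add2r.
exists z, (fun i => enum_val (widen_ord ltF i)); split.
  by move=> i j /enum_val_inj/(congr1 val) /= ij; exact: val_inj.
by move=> i; have := enum_valP (widen_ord ltF i); rewrite inE => /andP[_ /eqP].
Qed.

Section Main.

Variables (K : closedFieldType) (V : lmodType K) (B : {biscalar V}).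
Variable k : form_kind.
Hypotheses (infV : infinite_dimensional V) (ndB : nondegenerate_form B).
Hypothesis kindB : form_of_kind k B.
Hypothesis two_neq0 : 2%:R != 0 :> K.
Variable kappa : Type.
Hypothesis kappa_uncountable : ~ countable [set: kappa].
Hypothesis satB : saturated B kappa.
Hypothesis homB : strongly_homogeneous B kappa.

Let frame := frame B.

(** As [c] has finitely many conjugates over [A], many inverses of the given automorphisms agree on
    it. Composing these automorphisms with one common inverse makes them fix [c], and amounts to a
    common change of variable in the inconsistent family. *)
Lemma divides_under_algebraic (A : frame) c P x (D : tup V x -> Prop) :
  annihilates (evZ (fN A) (fs A)) c P ->
  divides_under B (fixes A) D ->
  divides_under B (fun g => fixes A g /\ g sca c = c) D.
Proof.
set f := evZ _ _ => annP [l lD]; exists l => n.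
have [rs rsE] := closed_field_poly_normal (map_poly f P).
have rootE g : automorphism B g -> fixes A g -> (g sca c : K) \in rs.
  move=> autg gA; have [h hE] := aut_rmorphism autg.
  have : root (map_poly f P) (g sca c).
    apply/rootP; rewrite -hE.
    rewrite (_ : map_poly f P = map_poly h (map_poly f P)).
      by rewrite horner_map annP.2 rmorph0.
    rewrite -map_poly_comp; apply: eq_map_poly => r /=; rewrite hE.
    by symmetry; apply: (fixes_named (s := sca) autg gA); exists r.
  rewrite rsE rootZ ?root_prod_XsubC //.
  by rewrite lead_coef_eq0; exact: annP.1.
have [g [gP gD]] := lD (size rs * n).+1.
have /choice[g' g'P] i : exists g', [/\ automorphism B g', fixes A g' &
    forall s, cancel (g' s) (g i s)].
  have [autg gA] := gP i; have [g' [autg' gg' g'g]] := aut_inv autg.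
  exists g'; split=> //; have [gk ge] := gA.
  by split=> j lt; [rewrite -{1}(gk j lt) gg' | rewrite -{1}(ge j lt) gg'].
have [i _||z [h [injh hz]]] :=
    @pigeonhole _ rs _ (fun i => g' i sca c : K) n [set: 'I_(size rs * n).+1].
- by have [autg' g'A _] := g'P i; exact: rootE.
- by rewrite cardsT card_ord.
(* The pigeonhole gives one index more than the [n] required, so the common inverse at [ord0] exists
   even for [n = 0]. *)
pose w (i : 'I_n) : 'I_n.+1 := widen_ord (leqnSn n) i.
exists (fun i s d => g (h (w i)) s (g' (h ord0) s d)); split=> [i|f0 injf].
  have [autg gA] := gP (h (w i)); have [autg' g'A _] := g'P (h ord0).
  split; first exact: aut_comp.
  split; first by split=> j lt; rewrite ?g'A.1 ?gA.1 // g'A.2 // gA.2.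
  have [_ _ g'g] := g'P (h (w i)).
  have /= -> := etrans (hz ord0) (esym (hz (w i))); exact: (g'g sca).
move=> [a aD]; apply: (gD (fun j => h (w (f0 j)))).
  move=> i j /injh/(congr1 val) /= ij; apply: injf; exact: val_inj.
by exists (act (g' (h ord0)) a).
Qed.

(** * Absorbing elements while all the given sets keep dividing *)

Variables (Cb : frame) (x : ctx) (M : nat) (D : 'I_M -> tup V x -> Prop).
Hypothesis invD : forall j, invariant_under B (fixes Cb) (D j).

Definition all_divide (A : frame) :=
  forall j, divides_under B (fixes A) (D j).

Lemma absorb_scalar (A : frame) c : all_divide A -> exists g (A' : frame),
  [/\ automorphism B g, fixes A g, frame_le A A' & all_divide A'] /\
  [/\ fn A' = fn A, fe A' = fe A & scalar_in A' (g sca c)].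
Proof.
move=> divA.
suff [g [autg gA gdiv]] : exists g, [/\ automorphism B g, fixes A g &
    forall j, divides_under B
      (fun q => fixes A q /\ q sca (g sca c) = g sca c) (D j)].
  have [A' [le kc n' e' A'fix]] := add_scalar A (g sca c).
  exists g, A'; split=> //; split=> // j.
  by apply: divides_underS (gdiv j) => q _ [/A'fix qA /qA].
have [[P annP]|notalg] :=
    pselect (exists P, annihilates (evZ (fN A) (fs A)) c P).
  exists (fun s d => d); split=> //; first exact: aut_id.
  by move=> j; exact: divides_under_algebraic annP (divA j).
have tc : holds_on (s := sca) (@gen_scalar K V) A c.
  move=> P Pc; apply/eqP; apply: contra_notT notalg => P0; by exists P.
have [C _|C e e' _|C C' e _ _||g [autg gA gdiv]] := amalgamation kindB Cb
    (A := A) (s := sca) (Gen := @gen_scalar K V) (e0 := c) _ _ _ _ tc.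
- exact: (gen_scalar_exists kappa_uncountable satB C).
- exact: (gen_scalar_uniq infV ndB kindB two_neq0 kappa_uncountable satB homB).
- exact: gen_scalar_mono.
- by move=> g N t n e d autg _ _; exact: (gen_scalar_aut autg).
by exists g; split=> // j; exact: gdiv (invD (j := j)) (divA j).
Qed.

Lemma absorb_scalars (A : frame) m (z : nat -> K) : all_divide A ->
  exists g (A' : frame),
  [/\ automorphism B g, fixes A g, frame_le A A' & all_divide A'] /\
  [/\ fn A' = fn A, fe A' = fe A &
    forall i, (i < m)%N -> scalar_in A' (g sca (z i))].
Proof.
move=> divA; elim: m => [|m [g [A1 [[autg gA le1 div1] [n1 e1 k1]]]]].
  exists (fun s d => d), A; split=> //; split=> //; first exact: aut_id.
  exact: frame_le_refl.
have [h [A2 [[auth hA le2 div2] [n2 e2 k2]]]] :=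
  absorb_scalar (g sca (z m)) div1.
exists (fun s d => h s (g s d)), A2; split; split; rewrite ?n2 ?e2 //.
- exact: aut_comp.
- have hA' := covers_fixes auth (frame_le_covers le1) hA.
  by split=> j lt; rewrite ?gA.1 ?hA'.1 // gA.2 // hA'.2.
- exact: frame_le_trans le1 le2.
move=> i; rewrite ltnS leq_eqVlt => /orP[/eqP->//|/k1 ki].
(* The scalars absorbed so far are named in [A1], which [h] fixes, so they are not moved again. *)
rewrite (fixes_named (s := sca) auth hA ki).
exact: (covers_named (s := sca) (frame_le_covers le2) ki).
Qed.

Lemma absorb_vector (A : frame) v : all_divide A -> exists g (A' : frame),
  [/\ automorphism B g, fixes A g, frame_le A A' & all_divide A'] /\
  vector_in A' (g vec v).
Proof.
move=> divA; have [[c cE]|vn] := pselect (inspan (fn A) (fe A) v).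
  have [g [A' [[autg gA le div'] [n' e' kc]]]] := absorb_scalars (fn A) c divA.
  exists g, A'; split=> //; exists (fun i => g sca (c i)).
  rewrite n' e' cE (aut_sum (fn A) c (fe A) autg); split=> //.
  by apply: eq_bigr => i _; rewrite gA.2.
pose z i := if (i < fn A)%N then B v (fe A i) else B v v.
have [g [A1 [[autg gA le1 div1] [n1 e1 kz]]]] := absorb_scalars (fn A).+1 z divA.
set v1 : V := g vec v.
have v1n : ~ inspan (fn A1) (fe A1) v1.
  move=> [c cE]; apply: vn; have [h [auth gh hg]] := aut_inv autg.
  exists (fun i => h sca (c i)).
  rewrite -[v](gh vec) -/v1 cE n1 e1 (aut_sum _ _ _ auth).
  by apply: eq_bigr => i _; rewrite -{1}(gA.2 i) // gh.
have v1e i : (i < fn A1)%N -> scalar_in A1 (B v1 (fe A1 i)).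
  rewrite n1 e1 => lt; have := kz i (leqW lt); rewrite /z lt.
  by rewrite (aut_form autg) gA.2.
have v11 : scalar_in A1 (B v1 v1).
  by have := kz _ (ltnSn (fn A)); rewrite /z ltnn (aut_form autg).
pose Gen := @gen_vector K V B (fn A1) v1.
(* Over [A1] itself no vectors remain, and a polynomial in zero variables has the same value at
   every point, so genericity of the products is vacuous. *)
have gv1 : holds_on (s := vec) Gen A1 v1.
  by split=> //; rewrite subnn => P /= P0 y; rewrite -[RHS]P0; exact: eq_tower_ev.
have [C leC|C e e' leC|C C' e leC leC'||h [auth hA hdiv]] := amalgamation kindB Cb
    (A := A1) (s := vec) (Gen := Gen) (e0 := v1) _ _ _ _ gv1.
- exact: (gen_vector_exists infV ndB kindB two_neq0 kappa_uncountable satB).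
- exact: (gen_vector_uniq infV ndB kindB two_neq0 kappa_uncountable satB homB
    v1e v11).
- exact: (gen_vector_mono ndB kindB v1e).
- move=> q N t n e d autq qA ee; apply: gen_vector_aut => //.
    move=> i lt; rewrite ee // qA.2 //.
    exact: (fixes_named (s := sca) autq qA (v1e i lt)).
  exact: (fixes_named (s := sca) autq qA v11).
set v2 : V := h vec v1.
have v2n : ~ inspan (fn A1) (fe A1) v2.
  move=> v2in; apply: v1n; have [h' [auth' hh' h'h]] := aut_inv auth.
  rewrite -[v1](hh' vec); apply: aut_inspan => //.
  have [hk he] := hA.
  by split=> j lt; [rewrite -{1}(hk j lt) hh' | rewrite -{1}(he j lt) hh'].
have v2e i : (i < fn A1)%N -> scalar_in A1 (B v2 (fe A1 i)).
  move=> lt; rewrite -(hA.2 i lt) -(aut_form auth).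
  by rewrite (fixes_named (s := sca) auth hA (v1e i lt)); exact: v1e.
have v22 : scalar_in A1 (B v2 v2).
  by rewrite -(aut_form auth) (fixes_named (s := sca) auth hA v11).
have [A2 [le2 v2A2 A2fix]] := add_vector kindB v2n v2e v22.
exists (fun s d => h s (g s d)), A2; split=> //; split.
- exact: aut_comp.
- have hA' := covers_fixes auth (frame_le_covers le1) hA.
  by split=> j lt; rewrite ?gA.1 ?hA'.1 // gA.2 // hA'.2.
- exact: frame_le_trans le1 le2.
move=> j; apply: divides_underS (hdiv _ _ (invD (j := j)) (div1 j)) => q _ [qA].
exact: A2fix.
Qed.

Lemma absorb_tup (A : frame) y (a : tup V y) : all_divide A ->
  exists g (A' : frame),
  [/\ automorphism B g, fixes A g, frame_le A A' & all_divide A'] /\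
  forall i, named A' (act g a i).
Proof.
move=> divA; elim: y a => [|s y IH] a.
  exists (fun s d => d), A; split=> [|[]]; split=> //; first exact: aut_id.
  exact: frame_le_refl.
have [g [A1 [[autg gA le1 div1] a1]]] := IH (fun j => a (Some j)).
have [h [A2 [[auth hA le2 div2] a2]]] : exists h (A' : frame),
    [/\ automorphism B h, fixes A1 h, frame_le A1 A' & all_divide A'] /\
    named A' (h s (g s (a None))).
  move: (g s (a None)) => {a a1 IH} d.
  case: s d => [v|c]; first exact: absorb_vector.
  by have [h [A2 [? [_ _ ?]]]] := absorb_scalar c div1; exists h, A2.
exists (fun s d => h s (g s d)), A2; split; first split=> //.
- exact: aut_comp.
- have hA' := covers_fixes auth (frame_le_covers le1) hA.
  by split=> j lt; rewrite ?gA.1 ?hA'.1 // gA.2 // hA'.2.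
- exact: frame_le_trans le1 le2.
move=> [j|]; last exact: a2.
rewrite /act /= (fixes_named auth hA (a1 j)).
exact: covers_named (frame_le_covers le2) (a1 j).
Qed.

Lemma no_cover (A : frame) (a : tup V x) : all_divide A ->
  exists g, [/\ automorphism B g, fixes A g & forall j, ~ D j (act g a)].
Proof.
move=> /(absorb_tup a)[g [A' [[autg gA _ div'] aA']]].
exists g; split=> // j Da; have [l lD] := div' j.
have [q [qP qD]] := lD l; apply: (qD id) => //.
exists (act g a) => i; have [autq qA] := qP i.
rewrite (_ : act (q i) (act g a) = act g a) //.
apply: functional_extensionality_dep => m.
exact: (fixes_named autq qA (aA' m)).
Qed.

End Main.

Theorem proposition8p1 (p : nat) (hp : p = 0%N \/ (prime p /\ p <> 2%N))
    (k : form_kind) (K : closedFieldType) (V : lmodType K)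
    (B : {biscalar V}%R) (kappa : Type) (A : set (elt V)) :
  model_of_Tinfty k p B -> monster B kappa -> small kappa A ->
  extension_base B A.
Proof.
move=> [charK infV ndB kindB] [unc satB homB] _ x phi phiA [a phi_a].
move=> [M [psi [psi_div cov]]].
have two_neq0 : 2%:R != 0 :> K.
  apply/negP => two0; have char2 : 2%N \in [pchar K] by rewrite inE.
  move: charK; rewrite /has_char; case: eqP => [_ /(_ 2%N)|p0 charp].
    by rewrite char2.
  have [//|[_]] := hp; apply.
  by have := pcharf_eq charp 2%N; rewrite char2 => /esym/eqP->.
have ind0 : indep 0 (fun=> 0 : V) by move=> c _ i.
have gram0 i j : (i < 0)%N -> (j < 0)%N -> inZ 0 (fun=> 0 : K) (B 0 0) by [].
pose F0 := @Frame K V B _ _ _ _ ind0 gram0.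
have [A0 [_ phiA0 A0fix]] := add_tup kindB F0 (pval (p := phi)).
have /choice[F FP] j : exists F : frame B,
    forall i, named F (pval (p := psi j) i).
  by have [F [_ ? _]] := add_tup kindB F0 (pval (p := psi j)); exists F.
have [Cb [_ CbF]] := cover_frames kindB F0 F.
have invD j : invariant_under B (fixes Cb) (fun a => holds B (psi j) a).
  move=> g autg gCb b; rewrite (holds_aut (psi j) b autg).
  rewrite (_ : act g (pval (p := psi j)) = pval (p := psi j)) //.
  apply: functional_extensionality_dep => i.
  exact: (fixes_named autg gCb (covers_named (CbF j) (FP j i))).
have divA0 : all_divide (fun j a => holds B (psi j) a) A0.
  (* An automorphism taking [b i] to the parameters of [psi j] pulls [psi j] back to its instance at
     [b i]. It can be chosen to fix the parameters of [phi], and then it fixes [A0]. *)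
  move=> j; have [l [b [b_type b_inc]]] := psi_div j; exists l => n.
  have /choice[g gP] i := same_type_aut unc homB phiA (b_type i).
  exists (fun i : 'I_n => g i); split=> [i|h injh [c cD]].
    have [autg _ gphi] := gP i; split=> //; apply: A0fix => //.
    by move=> m; rewrite -[in RHS]gphi.
  apply: (b_inc (fun i => h i)); first by move=> i1 i2 /val_inj/injh.
  exists c => i; have [autg gb _] := gP (h i).
  rewrite (holds_aut _ c autg) /= gb; exact: cD.
have [g [autg gA0 gD]] :=
  no_cover infV ndB kindB two_neq0 unc satB homB invD a divA0.
have phi_ga : holds B phi (act g a).
  move: phi_a; rewrite (holds_aut phi a autg).
  rewrite (_ : act g (pval (p := phi)) = pval (p := phi)) //.
  apply: functional_extensionality_dep => i.
  exact: (fixes_named autg gA0 (phiA0 i)).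
by have [j] := cov _ phi_ga; exact: gD.
Qed.
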